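(* The relation algebra $56_{65}$ has a finitely bounded universal square representation. Consequently, the network satisfaction problem for $56_{65}$ is in NP.
   Context: The relation algebra $56_{65}$ can be described concretely as follows. Its atoms are $\mathrm{id}, N, 0, 1$ and its elements are all subsets of $\{\mathrm{id},N,0,1\}$, with join $\sqcup$ the union, complement the set complement, $\bot=\emptyset$, $\top=\{\mathrm{id},N,0,1\}$, identity element $\{\mathrm{id}\}$, converse the identity map (every element is symmetric), and composition given on atoms by $x\circ y=\{z : (x,y,z)\text{ is allowed}\}$ and extended by union. A triple of atoms is allowed unless it is forbidden, where the forbidden triples are $(N,N,N),(1,1,1),(0,0,1),(0,1,0),(1,0,0)$ and all triples $(\mathrm{id},X,Y),(X,\mathrm{id},Y),(X,Y,\mathrm{id})$ with $X\neq Y$ atoms. A representation of a relation algebra $\mathbf{A}$ (with domain $A$) is a structure $\mathfrak{B}$ with domain $B$ interpreting each $a\in A$ as a binary relation $a^{\mathfrak{B}}\subseteq B^2$ such that: $\bot^{\mathfrak{B}}=\emptyset$; $\top^{\mathfrak{B}}=\bigcup_{a\in A}a^{\mathfrak{B}}$; $\mathrm{id}^{\mathfrak{B}}=\{(u,u):u\in B\}$; $\overline{a}^{\mathfrak{B}}=\top^{\mathfrak{B}}\setminus a^{\mathfrak{B}}$; $\breve{a}^{\mathfrak{B}}=\{(u,v):(v,u)\in a^{\mathfrak{B}}\}$; $(a\sqcup b)^{\mathfrak{B}}=a^{\mathfrak{B}}\cup b^{\mathfrak{B}}$; and $(a\circ b)^{\mathfrak{B}}=a^{\mathfrak{B}}\circ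 b^{\mathfrak{B}}$, where $R_1\circ R_2=\{(x,z):\exists y\,(x,y)\in R_1,(y,z)\in R_2\}$. It is square if $\top^{\mathfrak{B}}=B^2$, and finitely bounded if there is a finite set $\mathcal{F}$ of finite structures in the signature $A$ such that a structure $\mathfrak{C}$ in signature $A$ embeds into $\mathfrak{B}$ iff no member of $\mathcal{F}$ embeds into $\mathfrak{C}$. An $\mathbf{A}$-network is a pair $(V,f)$ with $V$ a finite set and $f\colon V^2\to A$; it is satisfiable in $\mathfrak{B}$ if there is $s\colon V\to B$ with $(s(x),s(y))\in f(x,y)^{\mathfrak{B}}$ for all $x,y\in V$, and satisfiable if it is satisfiable in some representation of $\mathbf{A}$. A representation is universal if every satisfiable $\mathbf{A}$-network is satisfiable in it. The network satisfaction problem for $\mathbf{A}$ asks, given an $\mathbf{A}$-network, whether it is satisfiable.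
   Formalization: In ''finitely bounded'' the structures C range over finite structures only (the standard meaning): for C of arbitrary cardinality no infinite representation, hence no universal one for 56_65, could be finitely bounded. *)

(* Defs.v *)
From HB Require Import structures.
From mathcomp Require Import all_boot.

Set Implicit Arguments.
Unset Strict Implicit.
Unset Printing Implicit Defensive.

(* Tarski's axioms; the Boolean reduct is axiomatised by Huntington's
   equations. *)
Record relAlg := RelAlg {
  ra_carrier :> finType;
  ra_join : ra_carrier -> ra_carrier -> ra_carrier;
  ra_compl : ra_carrier -> ra_carrier;
  ra_bot : ra_carrier;
  ra_top : ra_carrier;
  ra_id : ra_carrier;
  ra_conv : ra_carrier -> ra_carrier;
  ra_comp : ra_carrier -> ra_carrier -> ra_carrier;
  _ : commutative ra_join;
  _ : associative ra_join;
  _ : forall a b, ra_join (ra_compl (ra_join (ra_compl a) (ra_compl b)))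
                          (ra_compl (ra_join (ra_compl a) b)) = a;
  _ : forall a, ra_join a (ra_compl a) = ra_top;
  _ : ra_bot = ra_compl ra_top;
  _ : associative ra_comp;
  _ : left_distributive ra_comp ra_join;
  _ : right_id ra_id ra_comp;
  _ : involutive ra_conv;
  _ : {morph ra_conv : a b / ra_join a b};
  _ : forall a b, ra_conv (ra_comp a b) = ra_comp (ra_conv b) (ra_conv a);
  _ : forall a b, ra_join (ra_comp (ra_conv a) (ra_compl (ra_comp a b)))
                          (ra_compl b) = ra_compl b
}.

Inductive atom := At_id | At_N | At_0 | At_1.

Definition ord_of_atom (x : atom) : 'I_4 :=
  match x with
  | At_id => @Ordinal 4 0 isT | At_N => @Ordinal 4 1 isT
  | At_0 => @Ordinal 4 2 isT | At_1 => @Ordinal 4 3 isT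
  end.

Definition atom_of_ord (i : 'I_4) : atom :=
  match val i with 0 => At_id | 1 => At_N | 2 => At_0 | _ => At_1 end.

Lemma ord_of_atomK : cancel ord_of_atom atom_of_ord.
Proof. by case. Qed.

HB.instance Definition _ := Finite.copy atom (can_type ord_of_atomK).

Definition forbidden (x y z : atom) : bool :=
  [|| (x, y, z) \in [:: (At_N, At_N, At_N); (At_1, At_1, At_1);
                        (At_0, At_0, At_1); (At_0, At_1, At_0);
                        (At_1, At_0, At_0)],
      (x == At_id) && (y != z),
      (y == At_id) && (x != z) |
      (z == At_id) && (x != y)].

Definition allowed (x y z : atom) : bool := ~~ forbidden x y z.

Definition comp56 (a b : {set atom}) : {set atom} :=
  [set z | [exists x in a, [exists y in b, allowed x y z]]].

Definition conv56 (a : {set atom}) : {set atom} := a.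

Lemma mem_comp56 (a b : {set atom}) z :
  reflect (exists x y, [/\ x \in a, y \in b & allowed x y z])
          (z \in comp56 a b).
Proof.
rewrite inE; apply: (iffP existsP) => [[x /andP[xa /existsP[y /andP[yb h]]]]|].
  by exists x, y.
by move=> [x [y [xa yb h]]]; exists x; rewrite xa; apply/existsP; exists y; rewrite yb.
Qed.

Lemma allowed_assoc_r x y z u w : allowed x y u -> allowed u z w ->
  exists2 v, allowed y z v & allowed x v w.
Proof.
case: x; case: y; case: z; case: u; case: w => // _ _;
  solve [by exists At_id | by exists At_N | by exists At_0 | by exists At_1].
Qed.

Lemma allowedC x y z : allowed x y z = allowed y x z.
Proof. by case: x; case: y; case: z. Qed.

Lemma allowed_rot x y z : allowed x y z = allowed x z y.
Proof. by case: x; case: y; case: z. Qed.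

Lemma comp56C : commutative comp56.
Proof.
by move=> a b; apply/setP=> z; apply/mem_comp56/mem_comp56 => -[x [y [xa yb h]]];
  exists y, x; rewrite allowedC.
Qed.

Lemma comp56_sub a b c : comp56 (comp56 a b) c \subset comp56 a (comp56 b c).
Proof.
apply/subsetP => w /mem_comp56[u [z [/mem_comp56[x [y [xa yb h1]]] zc h2]]].
have [v hv1 hv2] := allowed_assoc_r h1 h2.
by apply/mem_comp56; exists x, v; split=> //; apply/mem_comp56; exists y, z.
Qed.

Lemma comp56A : associative comp56.
Proof.
move=> a b c; apply/eqP; rewrite eqEsubset comp56_sub andbT.
rewrite comp56C (comp56C b c) (comp56C (comp56 a b) c) (comp56C a b).
exact: comp56_sub.
Qed.

Lemma comp56Ul : left_distributive comp56 (@setU atom).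
Proof.
move=> a b c; apply/setP => z; rewrite in_setU.
apply/mem_comp56/orP.
  move=> [x [y [/setUP[xa|xb] yc h]]]; [left|right]; apply/mem_comp56;
  by exists x, y.
by move=> [] /mem_comp56[x [y [xa yc h]]]; exists x, y; rewrite inE xa ?orbT.
Qed.

Lemma comp56_id : right_id [set At_id] comp56.
Proof.
move=> a; apply/setP => z; apply/mem_comp56/idP.
  by move=> [x [y [xa /set1P-> h]]]; have <- : x = z by case: x z h {xa} => -[].
by move=> za; exists z, At_id; split; rewrite ?set11 //; case: (z).
Qed.

Lemma huntington56 (a b : {set atom}) :
  ~: (~: a :|: ~: b) :|: ~: (~: a :|: b) = a.
Proof. by apply/setP=> x; rewrite !inE; case: (x \in a); case: (x \in b). Qed.

Lemma conv56_comp a b : conv56 (comp56 a b) = comp56 (conv56 b) (conv56 a).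
Proof. exact: comp56C. Qed.

Lemma tarski56 a b : comp56 (conv56 a) (~: comp56 a b) :|: ~: b = ~: b.
Proof.
apply/setUidPr/subsetP => z /mem_comp56[x [y [xa]]].
rewrite !in_setC => yn h; apply: contra yn => zb.
by apply/mem_comp56; exists x, z; rewrite -allowed_rot.
Qed.

Definition ra56_65 : relAlg :=
  @RelAlg {set atom} (@setU atom) (@setC atom) set0 setT [set At_id]
    conv56 comp56
    (@setUC atom) (@setUA atom) huntington56 (@setUCr atom) (esym (@setCT atom))
    comp56A comp56Ul comp56_id (fun=> erefl) (fun _ _ => erefl)
    conv56_comp tarski56.

Record structure (A : Type) := Structure {
  dom :> Type;
  interp : A -> dom -> dom -> Prop
}.

Definition embeds (A : Type) (C D : structure A) : Prop :=
  exists2 e : C -> D, injective e &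
    forall (a : A) (u v : C), interp a u v <-> interp a (e u) (e v).

Definition finite_structure (A : Type) (C : structure A) : Prop :=
  exists n (e : 'I_n -> C), forall u : C, exists i, e i = u.

(* The structures C range over finite ones: for C of arbitrary cardinality no
   infinite structure would be finitely bounded, by compactness. *)
Definition finitely_bounded (A : Type) (B : structure A) : Prop :=
  exists k (F : 'I_k -> structure A),
    (forall i, finite_structure (F i)) /\
    forall C : structure A, finite_structure C ->
      (embeds C B <-> forall i, ~ embeds (F i) C).

Record representation (A : relAlg) (B : structure A) : Prop := {
  rep_bot : forall u v : B, ~ interp (ra_bot A) u v;
  rep_top : forall u v : B, interp (ra_top A) u v <-> exists a : A, interp a u v;
  rep_id : forall u v : B, interp (ra_id A) u v <-> u = v;
  rep_compl : forall (a : A) (u v : B),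
    interp (ra_compl a) u v <-> interp (ra_top A) u v /\ ~ interp a u v;
  rep_conv : forall (a : A) (u v : B), interp (ra_conv a) u v <-> interp a v u;
  rep_join : forall (a b : A) (u v : B),
    interp (ra_join a b) u v <-> interp a u v \/ interp b u v;
  rep_comp : forall (a b : A) (u w : B),
    interp (ra_comp a b) u w <-> exists2 v : B, interp a u v & interp b v w
}.

Definition square (A : relAlg) (B : structure A) : Prop :=
  forall u v : B, interp (ra_top A) u v.

Definition network (A : Type) (V : finType) := V -> V -> A.

Definition satisfiable_in (A : Type) (B : structure A) (V : finType)
    (f : network A V) : Prop :=
  exists s : V -> B, forall x y : V, interp (f x y) (s x) (s y).

Definition satisfiable (A : relAlg) (V : finType) (f : network A V) : Prop :=
  exists2 B : structure A, representation B & satisfiable_in B f.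

Definition universal (A : relAlg) (B : structure A) : Prop :=
  forall (V : finType) (f : network A V), satisfiable f -> satisfiable_in B f.

Inductive direction := Go_left | Stay | Go_right.

(* A tape alphabet consists of the blank [None], the input symbols
   [Some (inl _)] and auxiliary symbols [Some (inr _)].  A machine with
   [tm_aux_tapes] = k has k + 1 tapes.  [tm_output q] is [None] unless q is a
   halting state; it is [Some true] if q accepts and [Some false] if q rejects. *)
Record TM (Sigma : finType) := MkTM {
  tm_aux : finType;
  tm_symbol := option (Sigma + tm_aux)%type;
  tm_aux_tapes : nat;
  tm_state : finType;
  tm_start : tm_state;
  tm_output : tm_state -> option bool;
  tm_trans : tm_state -> {ffun 'I_tm_aux_tapes.+1 -> tm_symbol} ->
    tm_state * {ffun 'I_tm_aux_tapes.+1 -> tm_symbol * direction}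
}.

(* A two-way infinite tape: the first sequence lists the cells to the left of
   the head, nearest first; the second one lists the scanned cell and the cells
   to its right.  All cells not listed are blank. *)
Definition tape (S : Type) := (seq (option S) * seq (option S))%type.

Definition tape_read (S : Type) (t : tape S) : option S := head None t.2.

Definition tape_write (S : Type) (s : option S) (t : tape S) : tape S :=
  (t.1, s :: behead t.2).

Definition tape_move (S : Type) (d : direction) (t : tape S) : tape S :=
  match d with
  | Go_left => (behead t.1, head None t.1 :: t.2)
  | Stay => t
  | Go_right => (head None t.2 :: t.1, behead t.2)
  end.

Definition config (Sigma : finType) (M : TM Sigma) : Type :=
  (tm_state M * {ffun 'I_(tm_aux_tapes M).+1 -> tape (Sigma + tm_aux M)})%type.

Definition tm_init (Sigma : finType) (M : TM Sigma) (w : seq Sigma) : config M :=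
  (tm_start M,
   [ffun i => if i == ord0 then ([::], [seq Some (inl x) | x <- w])
              else ([::], [::])]).

Definition tm_step (Sigma : finType) (M : TM Sigma) (c : config M) : config M :=
  if tm_output c.1 is Some _ then c else
  let r := tm_trans c.1 [ffun i => tape_read (c.2 i)] in
  (r.1, [ffun i => tape_move (r.2 i).2 (tape_write (r.2 i).1 (c.2 i))]).

Definition tm_outcome (Sigma : finType) (M : TM Sigma) (w : seq Sigma)
    (t : nat) : option bool :=
  tm_output (iter t (@tm_step _ M) (tm_init M w)).1.

Definition language (Sigma : Type) := seq Sigma -> Prop.

Definition in_P (Sigma : finType) (L : language Sigma) : Prop :=
  exists (M : TM Sigma) (c d : nat), forall w : seq Sigma,
    exists2 b : bool, tm_outcome M w (c * size w ^ d + c) = Some b & (b <-> L w).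

(* The word x # y, with [None] as the separator #. *)
Definition word_pair (Sigma Delta : Type) (x : seq Sigma) (y : seq Delta) :
    seq (option (Sigma + Delta)) :=
  [seq Some (inl s) | s <- x] ++ None :: [seq Some (inr s) | s <- y].

Definition in_NP (Sigma : finType) (L : language Sigma) : Prop :=
  exists (Delta : finType) (R : language (option (Sigma + Delta))) (c d : nat),
    in_P R /\
    forall x : seq Sigma,
      L x <-> exists2 y : seq Delta,
                size y <= c * size x ^ d + c & R (word_pair x y).

(* The matrix of the network, row by row, each row being ended by [None]. *)
Definition encode_network (A : Type) (n : nat) (f : network A 'I_n) :
    seq (option A) :=
  flatten [seq rcons [seq Some (f i j) | j <- enum 'I_n] None | i <- enum 'I_n].

Definition NSP (A : relAlg) : language (option A) :=
  fun w => exists n (f : network A 'I_n), w = encode_network f /\ satisfiable f.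
Arguments NSP : clear implicits.

(* Main.v *)
Require Import Defs.
From HB Require Import structures.
From mathcomp Require Import all_boot all_order all_algebra.
From mathcomp Require Import boolp.
From mathcomp Require Import zify lra.

Set Implicit Arguments.
Unset Strict Implicit.
Unset Printing Implicit Defensive.

(** The universal representation is a circle.  Take points on R/2Z, the double
    cover of the circle R/Z, in general position, and colour a pair by 0 if its
    distance is < 1/3, by 1 if one point is < 1/3 from the antipode of the other, and by N
    otherwise.  Reducing modulo 1/3, a point becomes a rational with one of six
    hues.

    In every representation an N-edge has common neighbours of both parities
    (the parity of a path counts its 1-edges), which excludes cycles of length
    4 and 5 with an even number of 1-edges whose chords are all N.  Conversely,
    a finite colouring with only allowed triangles and without these even cycles
    lies on the circle: an N-edge ab splits the vertices into four classes
    arranged in cyclic order, vertices of one class are ordered by their colours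
    to the other classes, and these orders never conflict.  Hence the circle is
    universal, and its bounds have at most 5 elements.

    A position on the circle (rank and hue of each vertex) is an NP certificate,
    checked by comparing the ranks, written in unary, for all pairs. *)

(** * Colourings and positions on the circle *)

Definition all_atoms (P : atom -> bool) :=
  [&& P At_id, P At_N, P At_0 & P At_1].

Lemma all_atomsP P : all_atoms P -> forall x, P x.
Proof. by case/and4P=> ? ? ? ? []. Qed.

Definition is_close (x : atom) := match x with At_0 | At_1 => true | _ => false end.
Definition is_one (x : atom) := match x with At_1 => true | _ => false end.

Definition flip (b : bool) (x : atom) :=
  if b then match x with At_0 => At_1 | At_1 => At_0 | _ => x end else x.

(** A triangle coloured by 0 and 1 alone is allowed iff it has an even number of 1s, and the flips
    [p], [q] and [p (+) q] cancel modulo 2. The three hypotheses say that identity edges are not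
    flipped. *)
Lemma flip_allowed p q x y z :
  (x = At_id -> p = false) -> (y = At_id -> q = false) ->
  (z = At_id -> p = q) -> allowed x y z ->
  allowed (flip p x) (flip q y) (flip (p (+) q) z).
Proof.
by case: p; case: q; case: x; case: y; case: z => // H1 H2 H3 _;
   first [have := H1 erefl | have := H2 erefl | have := H3 erefl].
Qed.

Lemma flipK b : involutive (flip b).
Proof. by move=> x; case: b; case: x. Qed.

Definition even4 (x y z t : atom) :=
  [&& is_close x, is_close y, is_close z, is_close t &
      ~~ (is_one x (+) is_one y (+) is_one z (+) is_one t)].

Definition even5 (x y z t u : atom) :=
  [&& is_close x, is_close y, is_close z, is_close t, is_close u &
      ~~ (is_one x (+) is_one y (+) is_one z (+) is_one t (+) is_one u)].

Record good_coloring (V : Type) (c : V -> V -> atom) : Prop := {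
  gc_sym : forall x y, c x y = c y x;
  gc_id : forall x y, c x y = At_id <-> x = y;
  gc_tri : forall x y z, allowed (c x y) (c y z) (c x z);
  gc_C4 : forall x y z t, c x z = At_N -> c y t = At_N ->
    even4 (c x y) (c y z) (c z t) (c t x) = false;
  gc_C5 : forall x y z t u,
    c x z = At_N -> c y t = At_N -> c z u = At_N -> c t x = At_N ->
    c u y = At_N ->
    even5 (c x y) (c y z) (c z t) (c t u) (c u x) = false
}.

(** This is Seidel switching. On the double cover it replaces the points of the vertices selected by
    [sw] by their antipodes. *)
Definition switch (V : Type) (sw : V -> bool) (c : V -> V -> atom) x y :=
  flip (sw x (+) sw y) (c x y).

Lemma flip_N b x : flip b x = At_N -> x = At_N.
Proof. by case: b; case: x. Qed.

Lemma flip_id b x : flip b x = At_id <-> x = At_id.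
Proof. by case: b; case: x. Qed.

Lemma is_close_flip b x : is_close (flip b x) = is_close x.
Proof. by case: b; case: x. Qed.

Lemma is_one_flip b x : is_close x -> is_one (flip b x) = b (+) is_one x.
Proof. by case: b; case: x. Qed.

(** Every vertex of a cycle lies on two of its edges, so switching preserves the parity of the
    number of 1-edges; N-edges and identity edges are fixed. *)
Lemma switch_good V (sw : V -> bool) c :
  good_coloring c -> good_coloring (switch sw c).
Proof.
move=> [Hs Hi Ht H4 H5]; rewrite /switch; split.
- by move=> x y; rewrite addbC Hs.
- by move=> x y; rewrite flip_id.
- move=> x y z; have -> : sw x (+) sw z = (sw x (+) sw y) (+) (sw y (+) sw z).
    by case: (sw x); case: (sw y); case: (sw z).
  apply: flip_allowed => //; rewrite Hi => ->; rewrite ?addbb //.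
  exact: addbC.
- move=> x y z t /flip_N xz /flip_N yt; apply: contraFF (H4 x y z t xz yt).
  rewrite /even4 !is_close_flip.
  case/and5P=> h1 h2 h3 h4; rewrite h1 h2 h3 h4 !is_one_flip //=.
  by case: (sw x); case: (sw y); case: (sw z); case: (sw t);
     case: (is_one _); case: (is_one _); case: (is_one _); case: (is_one _).
- move=> x y z t u /flip_N xz /flip_N yt /flip_N zu /flip_N tx /flip_N uy.
  apply: contraFF (H5 x y z t u xz yt zu tx uy).
  rewrite /even5 !is_close_flip.
  case/and5P=> h1 h2 h3 h4 /andP[h5]; rewrite h1 h2 h3 h4 h5 !is_one_flip //=.
  by case: (sw x); case: (sw y); case: (sw z); case: (sw t); case: (sw u);
     case: (is_one _); case: (is_one _); case: (is_one _); case: (is_one _);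
     case: (is_one _).
Qed.

(* Cutting the double cover R/2Z of the circle R/Z into six arcs of length 1/3,
   this is the colour of two points whose difference lies in the arc m. *)
Definition sector_atom (m : nat) : atom :=
  match m %% 6 with 0 | 5 => At_0 | 1 | 4 => At_N | _ => At_1 end.

Definition point := (nat * 'I_6)%type.

(** The rank orders the remainders modulo 1/3 and the hue numbers the arc. From the smaller
    remainder to the larger one the arcs subtract without a borrow; the summand 6 keeps the
    truncated subtraction exact. *)
Definition point_atom (p q : point) : atom :=
  if p.1 == q.1 then At_id
  else if p.1 < q.1 then sector_atom (q.2 + 6 - p.2)
  else sector_atom (p.2 + 6 - q.2).

(** The bound on the ranks keeps them short when a certificate writes them in unary. *)
Definition placed (V : finType) (c : V -> V -> atom) :=
  exists p : V -> point,
    [/\ forall v, (p v).1 < #|V|,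
        forall u v, (p u).1 = (p v).1 -> u = v &
        forall u v, c u v = point_atom (p u) (p v)].

Lemma unswitch_placed (V : finType) (sw : V -> bool) (c : V -> V -> atom) :
  placed (switch sw c) -> placed c.
Proof.
move=> [p [pV pI pc]].
(* Three of the six arcs make up half of the double cover, so adding 3 to the hue moves a point to
   its antipode. *)
pose p' v : point := ((p v).1, inord (((p v).2 + 3 * sw v) %% 6)).
exists p'; split=> // u v.
have -> : c u v = flip (sw u (+) sw v) (point_atom (p u) (p v)).
  by rewrite -pc /switch flipK.
rewrite /point_atom /= !inordK ?ltn_mod //.
case: (p u) => ru [ku ltku]; case: (p v) => rv [kv ltkv] /=.
case: eqP => _ //; first by case: (sw u); case: (sw v).
have key b b' (k k' : nat) : k < 6 -> k' < 6 ->
    flip (b (+) b') (sector_atom (k + 6 - k')) =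
    sector_atom ((k + 3 * b) %% 6 + 6 - (k' + 3 * b') %% 6).
  by case: b; case: b'; case: k => [|[|[|[|[|[|k]]]]]];
     case: k' => [|[|[|[|[|[|k']]]]]].
by case: ifP => _; [rewrite addbC|]; apply: key.
Qed.

(** * Positions recovered from signed differences *)

Section Signed.
Variables (V : finType) (c : V -> V -> atom) (d : V -> V -> nat) (x0 : V).
(** Here [d x y] numbers the arc containing the difference from [x] to [y]. A difference inside arc
    m is reversed into arc 5 - m, and adding two differences produces at most one carry. *)
Hypothesis d_lt : forall x y, d x y < 6.
Hypothesis d_opp : forall x y, x != y -> d y x = 5 - d x y.
Hypothesis d_tri : forall x y z, x != y -> y != z -> x != z ->
  (d x y + d y z == d x z %[mod 6]) || ((d x y + d y z).+1 == d x z %[mod 6]).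
Hypothesis c_d : forall x y, x != y -> c x y = sector_atom (d x y).
Hypothesis c_id : forall x, c x x = At_id.

(** With [x0] at the origin, [k v] is the arc containing [v]. The sum [k u + d u v] has no carry
    when the remainder of [u] modulo 1/3 is below that of [v], and this defines [lt]. *)
Let k v := if v == x0 then 0 else d x0 v.
Let lt u v := (u != v) && (k u + d u v == k v %[mod 6]).

Let k_lt v : k v < 6. Proof. by rewrite /k; case: ifP. Qed.

Let k_tri u v : u != v ->
  (k u + d u v == k v %[mod 6]) || ((k u + d u v).+1 == k v %[mod 6]).
Proof.
move=> uv; rewrite /k; case: (eqVneq u x0) uv => [->|u0] uv.
  by rewrite (eq_sym v) (negPf uv) /= eqxx.
case: (eqVneq v x0) => [->|v0]; last by apply: d_tri; rewrite // eq_sym.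
rewrite (@d_opp x0) 1?eq_sym //; have := d_lt x0 u; lia.
Qed.

Let lt_irr u : lt u u = false. Proof. by rewrite /lt eqxx. Qed.

Let lt_total u v : u != v -> lt u v || lt v u.
Proof.
move=> uv; rewrite /lt uv (eq_sym v) uv /= (@d_opp u v) //.
by have := k_tri uv; have := d_lt u v; have := k_lt u; have := k_lt v; lia.
Qed.

Let lt_anti u v : lt u v -> lt v u = false.
Proof.
rewrite /lt => /andP[uv]; rewrite (@d_opp u v) // (eq_sym v) uv /=.
have := d_lt u v; have := k_lt u; have := k_lt v; lia.
Qed.

Let lt_trans v u w : lt u v -> lt v w -> lt u w.
Proof.
move=> luv lvw; have uw : u != w.
  by apply/eqP=> uw; move: (lt_anti luv); rewrite uw lvw.
move: luv lvw; rewrite /lt uw => /andP[uv huv] /andP[vw hvw] /=.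
have := d_tri uv vw uw; have := k_tri uw.
by have := d_lt u v; have := d_lt v w; have := d_lt u w;
   have := k_lt u; have := k_lt v; have := k_lt w; lia.
Qed.

Let r v := #|[set u | lt u v]|.

Let r_mono u v : lt u v -> r u < r v.
Proof.
move=> luv; apply/proper_card/properP; split.
  by apply/subsetP=> w; rewrite !inE => /lt_trans; apply.
by exists u; rewrite !inE ?lt_irr.
Qed.

(** The relation [lt] is a strict total order, so counting predecessors yields distinct ranks; with
    [k] as hue, the absence of a carry along [lt] gives back the arcs [d]. *)
Lemma signed_placed : placed c.
Proof.
exists (fun v => (r v, inord (k v))); split=> /=.
- move=> v; rewrite /r -cardsT; apply/proper_card/properP; split.
    exact: subsetT.
  by exists v; rewrite !inE ?lt_irr.
- move=> u v ruv; apply/eqP; apply: contraTT isT => uv.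
  by case/orP: (lt_total uv) => /r_mono; rewrite ruv ltnn.
move=> u v; rewrite /point_atom /= !inordK //.
case: (eqVneq u v) => [->|uv]; first by rewrite eqxx.
have key x y : lt x y -> sector_atom (k y + 6 - k x) = sector_atom (d x y).
  rewrite /lt /sector_atom => /andP[_ /eqP h].
  suff -> : (k y + 6 - k x) %% 6 = d x y %% 6 by [].
  by move: h; have := d_lt x y; have := k_lt x; have := k_lt y; lia.
case/orP: (lt_total uv) => l; have lr := r_mono l.
  by rewrite ltn_eqF // lr key // c_d.
rewrite gtn_eqF // ltnNge (ltnW lr) /= key // c_d // (@d_opp u v) //.
by have := d_lt u v; case: (d u v) => [|[|[|[|[|[|?]]]]]].
Qed.
End Signed.

(** * Finite checks for the classes around an N-edge *)

Definition code (x : atom) := match x with At_N => 1 | At_1 => 2 | _ => 0 end.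

(** For points following one another within half of the double cover, the forward differences lie in
    arcs 0, 1 and 2, coloured 0, N and 1. These arcs add up with a carry of at most one. *)
Definition step_ok (xy yz xz : atom) :=
  (code xz == code xy + code yz) || (code xz == (code xy + code yz).+1).

(* Fix an N-edge ab.  Class 0 consists of the vertices at N from b, class 2 of
   those at N from a; the common neighbours of a and b with colours of equal
   (different) parity form class 1 (class 3).  The classes lie in this cyclic
   order around the circle, and [class_ok i j] lists the colours possible
   between the classes i < j. *)
Definition class_ok (i j : nat) (x : atom) :=
  match x with
  | At_id => false
  | At_N => true
  | At_0 => (i, j) \in [:: (0, 1); (0, 2); (1, 2); (2, 3)]
  | At_1 => (i, j) \in [:: (0, 2); (0, 3)]
  end.

(** What [v] requires for [u] to precede [u'] in their class: the earlier of the two is farther from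
    later classes and nearer to earlier ones. *)
Definition mono_at (iu iv : nat) (uv u'v : atom) :=
  if iu < iv then code u'v <= code uv
  else if iv < iu then code uv <= code u'v else true.

Definition cross_ok i j x :=
  if i < j then class_ok i j x else if j < i then class_ok j i x
  else (x == At_0) || (x == At_id).

Definition three_ok (i j k : nat) (xy yz xz : atom) :=
  allowed xy yz xz &&
  (if (i < j) && (j < k) then step_ok xy yz xz else
   if (i < k) && (k < j) then step_ok xz yz xy else
   if (j < i) && (i < k) then step_ok xy xz yz else
   if (j < k) && (k < i) then step_ok yz xz xy else
   if (k < i) && (i < j) then step_ok xz xy yz else
   if (k < j) && (j < i) then step_ok yz xy xz else true).

(** A conditional instead of a boolean implication lets call-by-value evaluation prune the
    enumeration. *)
Notation "'IF' a 'then' b" := (if a then b else true) (at level 200, only parsing).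

(** Vertices [u] and [u'] of class [i], [v] of class [j] and [v'] of class [k] are represented by
    their mutual colours. The excluded even cycles are u u' v' v and u' u v' v. *)
Definition conflict_test :=
  all (fun i => all (fun j => all (fun k =>
   IF (i != j) && (i != k) then
   all_atoms (fun uv => IF cross_ok i j uv then
   all_atoms (fun u'v => IF cross_ok i j u'v && allowed uv u'v At_0 then
   IF ~~ mono_at i j uv u'v then
   all_atoms (fun vv' => IF cross_ok j k vv' then
   all_atoms (fun uv' => IF cross_ok i k uv' && three_ok i j k uv vv' uv' then
   all_atoms (fun u'v' =>
     IF cross_ok i k u'v' && three_ok i j k u'v vv' u'v' then
     IF allowed uv' u'v' At_0 then
     IF (~~ [&& uv' == At_N, u'v == At_N & even4 At_0 u'v' vv' uv]) then
     IF (~~ [&& u'v' == At_N, uv == At_N & even4 At_0 uv' vv' u'v]) then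
     mono_at i k u'v' uv')))))) (iota 0 4)) (iota 0 4)) (iota 0 4).

Lemma conflict_testT : conflict_test. Proof. by vm_compute. Qed.

Definition in_class (i : nat) (xa xb : atom) :=
  match i with
  | 0 => ((xa == At_0) || (xa == At_id)) && (xb == At_N)
  | 1 => (xa == At_0) && (xb == At_0)
  | 2 => (xa == At_N) && ((xb == At_0) || (xb == At_id))
  | _ => (xa == At_1) && (xb == At_0)
  end.

(** The excluded even cycle is a x b y, with chords ab and xy. *)
Definition cross_test :=
  all (fun i => all (fun j =>
   all_atoms (fun xa => all_atoms (fun xb => IF in_class i xa xb then
   all_atoms (fun ya => all_atoms (fun yb => IF in_class j ya yb then
   all_atoms (fun xy => IF allowed xa ya xy && allowed xb yb xy then
     IF (~~ ((xy == At_N) && even4 xa xb yb ya)) then cross_ok i j xy)))))) (iota 0 4)) (iota 0 4).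

Lemma cross_testT : cross_test. Proof. by vm_compute. Qed.

(** The excluded even cycles are y x z b, x z y a and x y z a, followed by the pentagons a x z b y
    and a x y b z. *)
Definition step_test :=
  all (fun i => all (fun j => all (fun k => IF (i < j) && (j < k) then
   all_atoms (fun xa => all_atoms (fun xb => IF in_class i xa xb then
   all_atoms (fun ya => all_atoms (fun yb => IF in_class j ya yb then
   all_atoms (fun za => all_atoms (fun zb => IF in_class k za zb then
   all_atoms (fun xy => IF [&& cross_ok i j xy, allowed xa ya xy & allowed xb yb xy] then
   all_atoms (fun yz => IF [&& cross_ok j k yz, allowed ya za yz & allowed yb zb yz] then
   all_atoms (fun xz =>
   IF [&& cross_ok i k xz, allowed xa za xz & allowed xb zb xz] then
   IF allowed xy yz xz then
   IF (~~ [&& yz == At_N, xb == At_N & even4 xy xz zb yb]) then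
   IF (~~ [&& xy == At_N, za == At_N & even4 xz yz ya xa]) then
   IF (~~ [&& xz == At_N, ya == At_N & even4 xy yz za xa]) then
   IF (~~ [&& za == At_N, xb == At_N, yz == At_N, xy == At_N & even5 xa xz zb yb ya]) then
   IF (~~ [&& ya == At_N, xb == At_N, yz == At_N, xz == At_N & even5 xa xy yb zb za]) then
     step_ok xy yz xz)))))))))) (iota 0 4)) (iota 0 4)) (iota 0 4).

Lemma step_testT : step_test. Proof. by vm_compute. Qed.

(** * The linear order of the vertices *)

Section ClassOrder.
Variables (V : finType) (c : V -> V -> atom) (cl : V -> nat).
Hypothesis gc : good_coloring c.
Hypothesis cl_lt : forall v, cl v < 4.
Hypothesis cl_cross : forall u v, cross_ok (cl u) (cl v) (c u v).
Hypothesis cl_step : forall x y z, cl x < cl y -> cl y < cl z ->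
  step_ok (c x y) (c y z) (c x z).

Let le u u' := [forall v, mono_at (cl u) (cl v) (c u v) (c u' v)].

Let three x y z : three_ok (cl x) (cl y) (cl z) (c x y) (c y z) (c x z).
Proof.
rewrite /three_ok (gc_tri gc) /=.
case: ifP => [/andP[? ?]|_]; first exact: cl_step.
case: ifP => [/andP[? ?]|_]; first by rewrite (gc_sym gc y z); apply: cl_step.
case: ifP => [/andP[? ?]|_]; first by rewrite (gc_sym gc x y); apply: cl_step.
case: ifP => [/andP[? ?]|_].
  by rewrite (gc_sym gc x z) (gc_sym gc x y); apply: cl_step.
case: ifP => [/andP[? ?]|_].
  by rewrite (gc_sym gc x z) (gc_sym gc y z); apply: cl_step.
case: ifP => [/andP[? ?]|_] //.
by rewrite (gc_sym gc y z) (gc_sym gc x y) (gc_sym gc x z); apply: cl_step.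
Qed.

Let same_class u u' : u != u' -> cl u = cl u' -> c u u' = At_0.
Proof.
move=> uu' e; have := cl_cross u u'; rewrite /cross_ok e ltnn.
by case/orP=> /eqP // /(gc_id gc) e'; rewrite e' eqxx in uu'.
Qed.

Let mem_cl v : cl v \in iota 0 4. Proof. by rewrite mem_iota cl_lt. Qed.

(** This makes [le] total on every class: once some [v] prevents [u] from preceding [u'], all
    vertices agree on the opposite order. *)
Lemma conflict_free u u' v v' : u != u' -> cl u = cl u' ->
  ~~ mono_at (cl u) (cl v) (c u v) (c u' v) ->
  mono_at (cl u) (cl v') (c u' v') (c u v').
Proof.
move=> uu' e nm.
have [ne|ne] := eqVneq (cl u) (cl v').
  by rewrite /mono_at ne ltnn.
have ne' : cl u != cl v by apply: contraNneq nm => ->; rewrite /mono_at ltnn.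
have c0 := same_class uu' e.
have := allP (allP (allP conflict_testT _ (mem_cl u)) _ (mem_cl v)) _ (mem_cl v').
rewrite ne ne' /=.
move=> /all_atomsP/(_ (c u v)); rewrite cl_cross.
move=> /all_atomsP/(_ (c u' v)); rewrite {1}e cl_cross /=.
have t x : allowed (c u x) (c u' x) At_0.
  by rewrite -c0 (gc_sym gc u' x) (gc_tri gc).
rewrite t nm.
move=> /all_atomsP/(_ (c v v')); rewrite cl_cross.
move=> /all_atomsP/(_ (c u v')); rewrite cl_cross three /=.
move=> /all_atomsP/(_ (c u' v')); rewrite {1 2}e cl_cross three t /=.
have -> : [&& c u v' == At_N, c u' v == At_N & even4 At_0 (c u' v') (c v v') (c u v)] = false.
  apply/and3P => -[/eqP h1 /eqP h2]; rewrite -c0 (gc_sym gc v v') (gc_sym gc u v).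
  by rewrite (gc_C4 gc).
have -> : [&& c u' v' == At_N, c u v == At_N & even4 At_0 (c u v') (c v v') (c u' v)] = false.
  apply/and3P => -[/eqP h1 /eqP h2].
  by rewrite -c0 (gc_sym gc u u') (gc_sym gc v v') (gc_sym gc u' v) (gc_C4 gc).
by [].
Qed.

Let mono_tr u u' u'' v : cl u = cl u' ->
  mono_at (cl u) (cl v) (c u v) (c u' v) ->
  mono_at (cl u') (cl v) (c u' v) (c u'' v) ->
  mono_at (cl u) (cl v) (c u v) (c u'' v).
Proof. by rewrite /mono_at => ->; case: ifP => _; [|case: ifP => _ //]; lia. Qed.

Let le_tr u u' u'' : cl u = cl u' -> le u u' -> le u' u'' -> le u u''.
Proof.
move=> e /forallP h /forallP h'; apply/forallP=> v; exact: mono_tr (h v) (h' v).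
Qed.

Let le_total u u' : cl u = cl u' -> le u u' || le u' u.
Proof.
move=> e; have [->|ne] := eqVneq u u'.
  by rewrite orbb; apply/forallP=> v; rewrite /mono_at; do 2?case: ifP.
apply/orP; case: (boolP (le u u')) => h; [by left|right].
have /forallPn[v nv] := h.
by apply/forallP=> v'; rewrite -e; apply: conflict_free nv.
Qed.

(** Vertices of one class with the same codes towards all other classes are ordered by their
    enumeration. *)
Definition prec u v := (cl u < cl v) ||
  [&& cl u == cl v, le u v & ~~ le v u || (enum_rank u < enum_rank v)].

Let prec_irr u : prec u u = false.
Proof. by rewrite /prec !ltnn orbF; case: (le u u); rewrite ?andbF. Qed.

Let prec_total u v : u != v -> prec u v || prec v u.
Proof.
move=> uv; rewrite /prec (eq_sym (cl v)); case: ltngtP => //= e.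
have : (enum_rank u < enum_rank v) || (enum_rank v < enum_rank u).
  by rewrite -neq_ltn; apply: contraNneq uv => /ord_inj/enum_rank_inj ->.
move: (le_total e); case: (le u v); case: (le v u) => //=.
Qed.

Let prec_trans v u w : prec u v -> prec v w -> prec u w.
Proof.
case/orP=> [h1|/and3P[/eqP e1 l1 r1]]; case/orP=> [h2|/and3P[/eqP e2 l2 r2]];
  rewrite /prec.
- by rewrite (ltn_trans h1).
- by rewrite -e2 h1.
- by rewrite e1 h2.
rewrite e1 e2 eqxx (le_tr e1 l1 l2) /= ltnn /=.
case: (boolP (le w u)) => //= lwu.
have lvu := le_tr e2 l2 lwu; have lwv := le_tr (esym (etrans e1 e2)) lwu l1.
by move: r1 r2; rewrite lvu lwv /=; apply: ltn_trans.
Qed.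

(** When two consecutive vertices share a class, their colour is 0. Then [le] gives one inequality
    between the codes, and the forbidden triangle 0, 0, 1 excludes a jump from 0 to 2. *)
Let prec_step x y z : prec x y -> prec y z -> step_ok (c x y) (c y z) (c x z).
Proof.
move=> pxy pyz; have pxz := prec_trans pxy pyz.
have ne s t : prec s t -> s != t by apply: contraTneq => ->; rewrite prec_irr.
have tri := gc_tri gc x y z.
case/orP: pxy (ne _ _ pxy) => [h1 _|/and3P[/eqP e1 l1 _] n1];
  case/orP: pyz (ne _ _ pyz) => [h2 _|/and3P[/eqP e2 l2 _] n2].
- exact: cl_step.
- move: tri; rewrite (same_class n2 e2).
  have := forallP l2 x; rewrite /mono_at ltnNge (ltnW h1) /= h1.
  rewrite (gc_sym gc y x) (gc_sym gc z x).
  by case: (c x y); case: (c x z).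
- move: tri; rewrite (same_class n1 e1).
  have := forallP l1 z; rewrite /mono_at e1 h2.
  by case: (c y z); case: (c x z).
by rewrite (same_class n1 e1) (same_class n2 e2) (same_class (ne _ _ pxz) (etrans e1 e2)).
Qed.

Lemma classes_placed (x0 : V) : placed c.
Proof.
have prec_anti u v : prec u v -> prec v u = false.
  by move=> h; apply/negP=> /(prec_trans h); rewrite prec_irr.
have code3 x : code x < 3 by case: x.
have sc x : x != At_id -> x = sector_atom (code x) by case: x.
(* Backward differences lie in arcs 5, 4 and 3, which carry the same colours as the forward arcs 0,
   1 and 2. *)
pose d u v := if prec u v then code (c u v) else 5 - code (c u v).
apply: (@signed_placed V c d x0).
- by move=> x y; rewrite /d; have := code3 (c x y); case: ifP; lia.
- move=> x y ne; rewrite /d (gc_sym gc y x).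
  have := code3 (c x y); case/orP: (prec_total ne) => h; rewrite h (prec_anti _ _ h); lia.
- move=> x y z xy yz xz.
  have st u v w : prec u v -> prec v w ->
    (code (c u w) == code (c u v) + code (c v w)) ||
    (code (c u w) == (code (c u v) + code (c v w)).+1) := @prec_step u v w.
  rewrite /d; have := code3 (c x y); have := code3 (c y z); have := code3 (c x z).
  (* Of the eight orientations of the triangle, two are cyclic and contradict transitivity; each of
     the others reduces to [st] for its sorted vertices. *)
  case/orP: (prec_total xy) => h1; rewrite ?h1 ?(prec_anti _ _ h1);
  case/orP: (prec_total yz) => h2; rewrite ?h2 ?(prec_anti _ _ h2);
  case/orP: (prec_total xz) => h3; rewrite ?h3 ?(prec_anti _ _ h3).
  + by have := st _ _ _ h1 h2; lia.
  + by have := prec_trans h1 (prec_trans h2 h3); rewrite prec_irr.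
  + by have := st _ _ _ h3 h2; rewrite (gc_sym gc z y); lia.
  + by have := st _ _ _ h3 h1; rewrite (gc_sym gc z y) (gc_sym gc z x); lia.
  + by have := st _ _ _ h1 h3; rewrite (gc_sym gc y x); lia.
  + by have := st _ _ _ h2 h3; rewrite (gc_sym gc y x) (gc_sym gc z x); lia.
  + by have := prec_trans h1 (prec_trans h3 h2); rewrite prec_irr.
  + by have := st _ _ _ h2 h1; rewrite (gc_sym gc y x) (gc_sym gc z x) (gc_sym gc z y); lia.
- move=> x y ne; have ni : c x y != At_id by apply: contraNneq ne => /(gc_id gc) ->.
  rewrite /d [LHS]sc //; case: ifP => // _.
  by have := code3 (c x y); case: (code _) => [|[|[|?]]].
by move=> x; apply/(gc_id gc).
Qed.
End ClassOrder.

(** * Colourings normalised around an N-edge *)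

Section Normalized.
Variables (V : finType) (c : V -> V -> atom) (a b : V) (cl : V -> nat).
Hypothesis gc : good_coloring c.
Hypothesis ab : c a b = At_N.
Hypothesis cl_lt : forall v, cl v < 4.
Hypothesis clP : forall v, in_class (cl v) (c v a) (c v b).

Let mem_cl v : cl v \in iota 0 4. Proof. by rewrite mem_iota cl_lt. Qed.

Let tri u v w : allowed (c u w) (c v w) (c u v).
Proof. by rewrite (gc_sym gc v w) (gc_tri gc). Qed.

Let cross u v : cross_ok (cl u) (cl v) (c u v).
Proof.
have := allP (allP cross_testT _ (mem_cl u)) _ (mem_cl v).
move=> /all_atomsP/(_ (c u a))/all_atomsP/(_ (c u b)); rewrite clP.
move=> /all_atomsP/(_ (c v a))/all_atomsP/(_ (c v b)); rewrite clP.
move=> /all_atomsP/(_ (c u v)); rewrite !tri /=.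
have -> : (c u v == At_N) && even4 (c u a) (c u b) (c v b) (c v a) = false => //.
apply/andP => -[/eqP uv]; rewrite (gc_sym gc u a) (gc_sym gc v b) => h.
have := gc_C4 gc (x := a) (y := u) (z := b) (t := v) ab uv.
by rewrite h.
Qed.

Let step x y z : cl x < cl y -> cl y < cl z -> step_ok (c x y) (c y z) (c x z).
Proof.
move=> xy yz.
have := allP (allP (allP step_testT _ (mem_cl x)) _ (mem_cl y)) _ (mem_cl z).
rewrite xy yz.
move=> /all_atomsP/(_ (c x a))/all_atomsP/(_ (c x b)); rewrite clP.
move=> /all_atomsP/(_ (c y a))/all_atomsP/(_ (c y b)); rewrite clP.
move=> /all_atomsP/(_ (c z a))/all_atomsP/(_ (c z b)); rewrite clP.
move=> /all_atomsP/(_ (c x y)); rewrite cross !tri.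
move=> /all_atomsP/(_ (c y z)); rewrite cross !tri.
move=> /all_atomsP/(_ (c x z)); rewrite cross !tri (gc_tri gc) /=.
have s := gc_sym gc; have ba : c b a = At_N by rewrite s.
case: ifP => [_|/negbFE/and3P[/eqP h1 /eqP h2 h3] _]; last first.
  have := gc_C4 gc (x := y) (y := x) (z := z) (t := b) h1 h2.
  by rewrite (s y x) (s b y) h3.
case: ifP => [_|/negbFE/and3P[/eqP h1 /eqP h2 h3] _]; last first.
  have := gc_C4 gc (x := x) (y := z) (z := y) (t := a) h1 h2.
  by rewrite (s z y) (s a x) h3.
case: ifP => [_|/negbFE/and3P[/eqP h1 /eqP h2 h3] _]; last first.
  have := gc_C4 gc (x := x) (y := y) (z := z) (t := a) h1 h2.
  by rewrite (s a x) h3.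
case: ifP => [_|/negbFE/and5P[/eqP h1 /eqP h2 /eqP h3 /eqP h4 h5] _]; last first.
  have := gc_C5 gc (x := a) (y := x) (z := z) (t := b) (u := y).
  rewrite (s a z) (s z y) (s a x) (s b y) (s y x) h5.
  by move=> /(_ h1 h2 h3 ba h4).
case: ifP => [//|/negbFE/and5P[/eqP h1 /eqP h2 /eqP h3 /eqP h4 h5] _].
have := gc_C5 gc (x := a) (y := x) (z := y) (t := b) (u := z).
rewrite (s a y) (s a x) (s b z) (s z x) h5.
by move=> /(_ h1 h2 h3 ba h4).
Qed.

Lemma normalized_placed : placed c.
Proof. exact: (classes_placed gc cl_lt cross step a). Qed.
End Normalized.

(** * Placement of an arbitrary good colouring *)

Definition class_of (xa xb : atom) :=
  if xb == At_N then 0 else if xa == At_N then 2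
  else if is_one xa (+) is_one xb then 3 else 1.

(** In classes 0 and 1 this turns a 1-edge to [a] into a 0-edge, in classes 2 and 3 a 1-edge to [b];
    in class 3 the edge to [a] then has colour 1. *)
Definition switch_of (xa xb : atom) :=
  if class_of xa xb < 2 then is_one xa else is_one xb.

Definition class_test := all_atoms (fun xa => all_atoms (fun xb =>
  IF allowed xa xb At_N then
  in_class (class_of xa xb) (flip (switch_of xa xb) xa) (flip (switch_of xa xb) xb))).

Lemma class_testT : class_test. Proof. by vm_compute. Qed.

Lemma good_placed (V : finType) (c : V -> V -> atom) :
  good_coloring c -> placed c.
Proof.
move=> gc; case: (pickP (fun ab : V * V => c ab.1 ab.2 == At_N)) => [[a b] /= /eqP ab|noN].
  pose sw v := switch_of (c v a) (c v b).
  apply: (@unswitch_placed _ sw).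
  have swa : sw a = false by rewrite /sw /switch_of /class_of ab /= (gc_id gc a a).2.
  have swb : sw b = false.
    by rewrite /sw /switch_of /class_of (gc_id gc b b).2 // (gc_sym gc b a) ab.
  apply: (@normalized_placed _ _ a b (fun v => class_of (c v a) (c v b))).
  - exact: switch_good.
  - by rewrite /switch swa swb ab.
  - by move=> v; rewrite /class_of; do 3?case: ifP.
  move=> v; rewrite /switch swa swb !addbF.
  have := class_testT => /all_atomsP/(_ (c v a))/all_atomsP/(_ (c v b)).
  suff -> : allowed (c v a) (c v b) At_N by [].
  by rewrite -ab (gc_sym gc v a) (gc_tri gc).
case: (pickP V) => [x0 _|V0]; last first.
  by exists (fun v => (0, ord0)); split=> v; have := V0 v.
(* Without N-edges, the vertices at 1 from [x0] and the remaining ones form two parts, with 0 inside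
   a part and 1 across. The opposite hues 0 and 3 realise this for any choice of distinct ranks. *)
exists (fun v => (enum_rank v : nat, if is_one (c x0 v) then inord 3 else ord0)).
split=> /=.
- by move=> v; apply: ltn_ord.
- by move=> u v /ord_inj/enum_rank_inj.
move=> u v; rewrite /point_atom /=; case: eqP => [/ord_inj/enum_rank_inj ->|ne].
  exact/(gc_id gc).
have ni : c u v <> At_id by move/(gc_id gc)=> uv; apply: ne; rewrite uv.
have := noN (u, v); have := noN (x0, u); have := noN (x0, v); rewrite /=.
have := gc_tri gc x0 u v; move: ni.
by case: (c x0 u); case: (c x0 v); case: (c u v) => //= *; rewrite ?inordK //; case: ifP.
Qed.

(** * Representations *)

Section Representation.
Variable S : structure ra56_65.
Hypothesis repS : representation S.

Definition holds_at (x : atom) (u v : S) := interp ([set x] : ra56_65) u v.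
(** A representation need not be square, so elements may be unrelated by the top relation; the
    following arguments stay among linked elements. *)
Definition linked (u v : S) := interp ([set: atom] : ra56_65) u v.

(** A finite element is the join of its atoms, and a representation turns joins into unions. *)
Lemma interp_atoms (a : {set atom}) u v :
  interp (a : ra56_65) u v <-> exists2 x, x \in a & holds_at x u v.
Proof.
have [n] := ubnP #|a|; elim: n a => // n IHn a lt_an.
have [->|[x xa]] := set_0Vmem a.
  by split=> [/(rep_bot repS)|[x]] //; rewrite inE.
have {}IHn : interp (a :\ x : ra56_65) u v <->
    exists2 y, y \in a :\ x & holds_at y u v.
  by apply: IHn; move: lt_an; rewrite (cardsD1 x) xa add1n ltnS.
rewrite -(setD1K xa) -[interp _ u v]/(interp (ra_join (r := ra56_65) [set x] (a :\ x)) u v).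
rewrite (rep_join repS) IHn.
split=> [[h|[y ya h]]|[y]].
- by exists x; rewrite // !inE eqxx.
- by exists y; rewrite // in_setU ya orbT.
by rewrite /= in_setU in_set1 => /orP[/eqP -> h|ya h]; [left|right; exists y].
Qed.

Lemma holds_at_inj x y u v : holds_at x u v -> holds_at y u v -> x = y.
Proof.
move=> hx hy; apply/eqP/negPn/negP => nxy.
have : interp (ra_compl (r := ra56_65) [set x]) u v.
  by apply/interp_atoms; exists y; rewrite // !inE eq_sym.
by case/(rep_compl repS).
Qed.

Definition atom_between (u v : S) : atom :=
  odflt At_id [pick x | `[< holds_at x u v >]].

Lemma atom_betweenP u v : linked u v -> holds_at (atom_between u v) u v.
Proof.
move=> /interp_atoms[x _ hx]; rewrite /atom_between; case: pickP => [y /asboolP|/(_ x)] //.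
by rewrite asboolT.
Qed.

Lemma holds_at_linked x u v : holds_at x u v -> linked u v.
Proof. by move=> h; apply/interp_atoms; exists x. Qed.

Lemma atom_betweenE x u v : holds_at x u v -> atom_between u v = x.
Proof.
move=> h; exact: holds_at_inj (atom_betweenP (holds_at_linked h)) h.
Qed.

Lemma holds_at_sym x u v : holds_at x u v -> holds_at x v u.
Proof. by move/(rep_conv repS). Qed.

Lemma linked_sym u v : linked u v -> linked v u.
Proof. by move/(rep_conv repS). Qed.

Lemma linked_trans v u w : linked u v -> linked v w -> linked u w.
Proof.
move=> uv vw; have : interp (ra_comp (r := ra56_65) setT setT) u w.
  by apply/(rep_comp repS); exists v.
by case/interp_atoms=> x _ /holds_at_linked.
Qed.

Lemma atom_between_sym u v : linked u v -> atom_between u v = atom_between v u.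
Proof. by move=> /atom_betweenP/holds_at_sym/atom_betweenE. Qed.

Lemma atom_between_id u v : linked u v -> atom_between u v = At_id <-> u = v.
Proof.
move=> uv; split=> [e|<-].
  by apply/(rep_id repS); have := atom_betweenP uv; rewrite e.
by apply: atom_betweenE; apply/(rep_id repS).
Qed.

Lemma atom_between_tri u v w : linked u v -> linked v w ->
  allowed (atom_between u v) (atom_between v w) (atom_between u w).
Proof.
move=> uv vw.
have : interp (ra_comp (r := ra56_65) [set atom_between u v] [set atom_between v w]) u w.
  by apply/(rep_comp repS); exists v; apply: atom_betweenP.
by case/interp_atoms=> z /mem_comp56[x [y [/set1P -> /set1P -> h]]] /atom_betweenE ->.
Qed.

Lemma atom_between_ext x y u w : linked u w -> allowed x y (atom_between u w) ->
  exists v, [/\ linked u v, atom_between u v = x & atom_between v w = y].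
Proof.
move=> uw xy.
have : interp (ra_comp (r := ra56_65) [set x] [set y]) u w.
  apply/interp_atoms; exists (atom_between u w); last exact: atom_betweenP.
  by apply/mem_comp56; exists x, y; rewrite !set11.
case/(rep_comp repS)=> v uv vw; exists v.
by rewrite (atom_betweenE uv) (atom_betweenE vw); split=> //; apply: holds_at_linked uv.
Qed.

(* Two common neighbours of an N-edge with opposite parities are forced to be
   at N from each other; this excludes the even cycles below. *)
Lemma atom_between_parity (b : bool) u w : linked u w ->
  atom_between u w = At_N ->
  exists v, [/\ linked u v, atom_between u v = At_0 &
                atom_between v w = if b then At_1 else At_0].
Proof. by move=> uw e; apply: atom_between_ext; rewrite // e; case: b. Qed.

Section Cycles.
Variables x y z t u : S.
Hypotheses (xy : linked x y) (xz : linked x z) (xt : linked x t) (xu : linked x u).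
Local Notation c := atom_between.

(** Take a common neighbour [w] of [x] and [z] of parity opposite to that of [y]. In an even cycle
    [t] has the parity of [y], so [w] is at N from both; with the chord yt this is the forbidden
    triangle N, N, N. *)
Lemma rep_C4 : c x z = At_N -> c y t = At_N ->
  even4 (c x y) (c y z) (c z t) (c t x) = false.
Proof.
move=> cxz cyt; apply/negP=> ev.
have [w [xw cxw cwz]] := atom_between_parity (~~ (is_one (c x y) (+) is_one (c y z))) xz cxz.
have wx := linked_sym xw; have yx := linked_sym xy; have zx := linked_sym xz.
have tx := linked_sym xt.
have h1 := atom_between_tri wx xy; have h2 := atom_between_tri (linked_trans wx xz) (linked_trans zx xy).
have h3 := atom_between_tri wx xt; have h4 := atom_between_tri (linked_trans wx xz) (linked_trans zx xt).
have h5 := atom_between_tri (linked_trans wx xy) (linked_trans yx xt).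
move: ev h1 h2 h3 h4 h5; rewrite (atom_between_sym wx) cxw cyt cwz.
rewrite (atom_between_sym (linked_trans zx xy)) (atom_between_sym xt) => {cxz cyt cxw cwz}.
case: (c x y) => //; case: (c y z) => //; case: (c z t) => //; case: (c t x) => //= _;
by case: (c w y) => //; case: (c w t).
Qed.

(** Again [w] has parity opposite to [y] and is at N from [y]. Since yt and yu are N, the edges wt
    and wu must be close. The even triangles zwt, twu and uwx then give the path z t u x the parity
    of z w x, so the whole cycle is odd. *)
Lemma rep_C5 : c x z = At_N -> c y t = At_N -> c z u = At_N -> c t x = At_N ->
  c u y = At_N -> even5 (c x y) (c y z) (c z t) (c t u) (c u x) = false.
Proof.
move=> cxz cyt czu ctx cuy; apply/negP=> ev.
have [w [xw cxw cwz]] := atom_between_parity (~~ (is_one (c x y) (+) is_one (c y z))) xz cxz.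
have wx := linked_sym xw; have yx := linked_sym xy; have zx := linked_sym xz.
have tx := linked_sym xt; have ux := linked_sym xu.
have h1 := atom_between_tri wx xy; have h2 := atom_between_tri (linked_trans wx xz) (linked_trans zx xy).
have h3 := atom_between_tri (linked_trans wx xy) (linked_trans yx xt).
have h4 := atom_between_tri (linked_trans wx xy) (linked_trans yx xu).
have h5 := atom_between_tri (linked_trans wx xz) (linked_trans zx xt).
have h6 := atom_between_tri wx xu.
have h7 := atom_between_tri (linked_trans wx xt) (linked_trans tx xu).
move: ev h1 h2 h3 h4 h5 h6 h7; rewrite (atom_between_sym wx) cxw cyt cwz.
rewrite (atom_between_sym (linked_trans zx xy)) (atom_between_sym xu).
rewrite (atom_between_sym (linked_trans yx xu)) cuy => {cxz cyt cxw cwz czu ctx cuy}.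
case: (c x y) => //; case: (c y z) => //; case: (c z t) => //; case: (c t u) => //;
case: (c u x) => //= _;
by case: (c w y) => //; case: (c w t) => //; case: (c w u).
Qed.
End Cycles.

Lemma rep_good (V : Type) (f : V -> S) : injective f ->
  (forall u v, linked (f u) (f v)) ->
  good_coloring (fun u v => atom_between (f u) (f v)).
Proof.
move=> fI fl; split.
- by move=> x y; apply: atom_between_sym.
- by move=> x y; rewrite atom_between_id //; split=> [/fI|->].
- by move=> x y z; apply: atom_between_tri.
- by move=> x y z t; apply: rep_C4.
by move=> x y z t u; apply: rep_C5.
Qed.
End Representation.

Lemma satisfiable_placed (V : finType) (f : network ra56_65 V) : satisfiable f ->
  exists p : V -> point, [/\ forall v, (p v).1 < #|V|,
    forall u v, (p u).1 = (p v).1 -> p u = p v &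
    forall u v, point_atom (p u) (p v) \in (f u v : {set atom})].
Proof.
move=> [S repS [s hs]].
(* Several vertices may have the same value, while a good colouring separates its vertices. The
   colouring is therefore taken on the image of [s], whose duplicates are removed by classical
   equality. *)
pose s' (v : V) : {classic S} := s v.
pose W := seq_sub (undup (codom s')).
pose g (w : W) : S := ssval w.
have lk u v : linked (s u) (s v).
  by have /(interp_atoms repS)[x _] := hs u v => /(holds_at_linked repS).
have gl (w w' : W) : linked (g w) (g w').
  have wP (w1 : W) : exists v, g w1 = s v.
    by case: w1 => w1 /=; rewrite mem_undup => /codomP[v ->]; exists v.
  by have [v ->] := wP w; have [v' ->] := wP w'; apply: lk.
have gI : injective g by move=> w w' h; apply: val_inj.
have [p [pW pI pc]] := good_placed (rep_good repS gI gl).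
have sP v : s' v \in undup (codom s') by rewrite mem_undup codom_f.
pose h v : W := SeqSub (sP v).
exists (fun v => p (h v)); split.
- move=> v; apply: leq_trans (pW _) _.
  by rewrite card_seq_sub ?undup_uniq // (leq_trans (size_undup _)) ?size_codom.
- by move=> u v /pI ->.
move=> u v; rewrite -pc; have /(interp_atoms repS)[x xf] := hs u v.
by move/(atom_betweenE repS)=> e; rewrite /g /= /s' e.
Qed.

(** * The circle *)

Section DyadicDensity.
Import Order.TTheory GRing.Theory Num.Theory.
Local Open Scope ring_scope.

(* The choice of the invariant is immaterial: only the density of each of its
   fibres matters. *)
Definition hue (q : rat) : 'I_6 := inord (logn 2 `|denq q|%N %% 6).

(** A fraction with odd numerator and denominator 2^e has hue e modulo 6. The choice e = 6n + k
    prescribes the hue, and a large n makes such fractions fine enough. *)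
Lemma hue_dense (x y : rat) (k : 'I_6) : x < y ->
  exists2 z, (x < z < y) & hue z = k.
Proof.
move=> xy.
have [n Hn] : exists n : nat, 3 < (y - x) * (2 ^ (6 * n + k))%N%:R.
  have yx : 0 < y - x by rewrite subr_gt0.
  pose n := (Num.truncn (3 / (y - x))).+1.
  exists n; rewrite mulrC -ltr_pdivrMr //.
  apply: lt_le_trans (truncnS_gt _) _; rewrite ler_nat -/n.
  have := ltn_expl (6 * n + k) (isT : (1 < 2)%N); lia.
set e := (6 * n + k)%N in Hn.
pose D : rat := (2 ^ e)%N%:R.
have D0 : 0 < D by rewrite ltr0n expn_gt0.
pose t : int := Num.floor (x * D / 2).
(* From 2t <= xD < 2t + 2 it follows that the odd number 2t + 3 exceeds xD and is at most xD + 3,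
   hence below yD. *)
pose m : int := 2 * t + 3.
have /andP[t1 t2] : t%:~R <= x * D / 2 < (t + 1)%:~R by apply: floor_itv.
exists (m%:~R / D).
  rewrite ltr_pdivlMr // ltr_pdivrMr //.
  rewrite /m; move: t1 t2 Hn; rewrite -/D !rmorphD /= !rmorphM /=.
  rewrite ler_pdivlMr // ltr_pdivrMr // => *; lra.
rewrite /hue.
have -> : denq (m%:~R / D) = (2 ^ e)%N :> int.
  have modd : odd `|m| by rewrite /m; lia.
  have two_e : (0 < 2 ^ e)%N by rewrite expn_gt0.
  rewrite /D pmulrn coprimeq_den; last by rewrite absz_nat coprimeXr // coprimen2.
  by case: eqP => // -[e0]; rewrite e0 in two_e.
rewrite absz_nat pfactorK //; apply: val_inj; rewrite /= inordK ?ltn_mod //.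
rewrite /e; have := ltn_ord k; lia.
Qed.
End DyadicDensity.

Section Circle.
Import Order.TTheory GRing.Theory Num.Theory.

Definition rat_atom (u v : rat) : atom :=
  if u == v then At_id
  else if (u < v)%R then sector_atom (hue v + 6 - hue u)
  else sector_atom (hue u + 6 - hue v).

Definition circle : structure ra56_65 :=
  @Structure ra56_65 rat (fun a u v => rat_atom u v \in (a : {set atom})).

Lemma rat_atom_sym u v : rat_atom u v = rat_atom v u.
Proof. by rewrite /rat_atom eq_sym; case: ltgtP. Qed.

Lemma rat_atom_lt u v : (u < v)%R -> rat_atom u v = sector_atom (hue v + 6 - hue u).
Proof. by move=> uv; rewrite /rat_atom uv; case: eqP uv => // ->; rewrite ltxx. Qed.

Lemma rat_atom_gt u v : (v < u)%R -> rat_atom u v = sector_atom (hue u + 6 - hue v).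
Proof. by move=> uv; rewrite rat_atom_sym rat_atom_lt. Qed.

Lemma rat_atom_id u : rat_atom u u = At_id.
Proof. by rewrite /rat_atom eqxx. Qed.

Lemma all_hues (P : nat -> bool) : all P (iota 0 6) -> forall k : 'I_6, P k.
Proof. by move=> /allP h k; apply: h; rewrite mem_iota ltn_ord. Qed.

Lemma sector_tri (i j k : 'I_6) :
  allowed (sector_atom (j + 6 - i)) (sector_atom (k + 6 - j)) (sector_atom (k + 6 - i)).
Proof.
have : all (fun i => all (fun j => all (fun k =>
    allowed (sector_atom (j + 6 - i)) (sector_atom (k + 6 - j)) (sector_atom (k + 6 - i)))
  (iota 0 6)) (iota 0 6)) (iota 0 6) by vm_compute.
by move=> /all_hues/(_ i)/all_hues/(_ j)/all_hues/(_ k).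
Qed.

Lemma allowed_ids x : allowed At_id x x && allowed x At_id x && allowed x x At_id.
Proof. by case: x. Qed.

Lemma rat_atom_tri u v w : allowed (rat_atom u v) (rat_atom v w) (rat_atom u w).
Proof.
have key x y z : (x < y)%R -> (y < z)%R -> allowed (rat_atom x y) (rat_atom y z) (rat_atom x z).
  move=> xy yz; rewrite !rat_atom_lt //; first exact: sector_tri.
  exact: lt_trans yz.
pose P x y z := allowed (rat_atom x y) (rat_atom y z) (rat_atom x z).
have s12 x y z : P x y z -> P y x z by rewrite /P allowed_rot (rat_atom_sym y x).
have s23 x y z : P x y z -> P x z y.
  by rewrite /P allowedC allowed_rot allowedC (rat_atom_sym z y).
have diag x y : P x x y.
  by rewrite /P rat_atom_id; have /andP[/andP[]] := allowed_ids (rat_atom x y).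
rewrite -/(P u v w).
case: (ltgtP u v) => [uv|vu|->]; last exact: diag.
  case: (ltgtP v w) => [vw|wv|<-]; first exact: key.
    case: (ltgtP u w) => [uw|wu|<-].
    - exact/s23/key.
    - exact/s23/s12/key.
    exact/s23/diag.
  exact/s12/s23/diag.
case: (ltgtP v w) => [vw|wv|<-].
- case: (ltgtP u w) => [uw|wu|<-].
  + exact/s12/key.
  + exact/s12/s23/key.
  exact/s23/diag.
- exact/s12/s23/s12/key.
exact/s12/s23/diag.
Qed.

(** By density, points of every hue exist below, between and above [u] and [w]. A search over the
    hues shows that one of these three positions always provides the required colours. *)
Lemma rat_atom_ext x y u w : allowed x y (rat_atom u w) ->
  exists v, rat_atom u v = x /\ rat_atom v w = y.
Proof.
wlog uw : x y u w / (u <= w)%R => [H|].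
  case/orP: (le_total u w) => h; first exact: H.
  rewrite rat_atom_sym allowedC => /H[] // v [h1 h2].
  by exists v; rewrite rat_atom_sym h2 rat_atom_sym h1.
have [-> xy|x0] := eqVneq x At_id.
  exists u; rewrite rat_atom_id; split=> //.
  by move: xy; case: y; case: (rat_atom u w).
have [-> xy|y0] := eqVneq y At_id.
  exists w; rewrite rat_atom_id; split=> //.
  by move: xy; case: x {x0}; case: (rat_atom u w).
have below k : exists2 z, (z < u)%R & hue z = k.
  by have [|z /andP[_ zu] hz] := @hue_dense (u - 1)%R u k; [lra|exists z].
have above k : exists2 z, (w < z)%R & hue z = k.
  by have [|z /andP[wz _] hz] := @hue_dense w (w + 1)%R k; [lra|exists z].
move: uw; rewrite le_eqVlt => /orP[/eqP uw|uw].
  rewrite uw rat_atom_id => xy; have <- : x = y by move: xy {x0 y0}; case: x; case: y.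
  have [k kx] : exists k : 'I_6, sector_atom (k + 6 - hue w) = x.
    have : all_atoms (fun x => IF x != At_id then all (fun i =>
      has (fun k => sector_atom (k + 6 - i) == x) (iota 0 6)) (iota 0 6)) by vm_compute.
    move=> /all_atomsP/(_ x); rewrite x0 => /all_hues/(_ (hue w))/hasP[k].
    by rewrite mem_iota => /= k6 /eqP kx; exists (Ordinal k6).
  have [z wz hz] := above k.
  by exists z; rewrite (rat_atom_lt wz) (rat_atom_gt wz) hz.
rewrite (rat_atom_lt uw) => xy.
have : all_atoms (fun x => IF x != At_id then all_atoms (fun y => IF y != At_id then
  all (fun i => all (fun j => IF allowed x y (sector_atom (j + 6 - i)) then
    has (fun k =>
     [|| (sector_atom (i + 6 - k) == x) && (sector_atom (j + 6 - k) == y),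
         (sector_atom (k + 6 - i) == x) && (sector_atom (j + 6 - k) == y) |
         (sector_atom (k + 6 - i) == x) && (sector_atom (k + 6 - j) == y)])
      (iota 0 6)) (iota 0 6)) (iota 0 6))) by vm_compute.
move=> /all_atomsP/(_ x); rewrite x0 => /all_atomsP/(_ y); rewrite y0.
move=> /all_hues/(_ (hue u))/all_hues/(_ (hue w)); rewrite xy => /hasP[k'].
rewrite mem_iota => /= k6; pose k := Ordinal k6; rewrite -[k']/(k : nat).
case/or3P=> /andP[/eqP <- /eqP <-].
- have [z zu hz] := below k; exists z.
  by rewrite (rat_atom_gt zu) (rat_atom_lt (lt_trans zu uw)) hz.
- have [z /andP[uz zw] hz] := hue_dense k uw; exists z.
  by rewrite (rat_atom_lt uz) (rat_atom_lt zw) hz.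
have [z wz hz] := above k; exists z.
by rewrite (rat_atom_lt (lt_trans uw wz)) (rat_atom_gt wz) hz.
Qed.

Lemma circle_representation : representation circle.
Proof.
split.
- by move=> u v; rewrite -[interp _ u v]/(is_true (rat_atom u v \in set0)) in_set0.
- move=> u v; split=> [h|_]; first by exists [set: atom].
  exact: in_setT.
- move=> u v; rewrite -[interp _ u v]/(is_true (rat_atom u v \in [set At_id])) in_set1.
  rewrite /rat_atom; have [->|uv] := eqVneq u v; split=> //.
    by case: ifP => _; rewrite /sector_atom; case: (_ %% 6) => [|[|[|[|[|[|?]]]]]].
  by move/eqP: uv.
- move=> a u v; rewrite -[interp (ra_compl a) u v]/(is_true (rat_atom u v \in ~: a)) in_setC.
  by split=> [/negP h|[_ /negP //]]; split=> //; apply: in_setT.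
- by move=> a u v; rewrite /= rat_atom_sym.
- move=> a b u v; rewrite -[interp (ra_join a b) u v]/(is_true (rat_atom u v \in a :|: b)).
  by rewrite in_setU; split=> /orP.
move=> a b u w; split=> [/mem_comp56[x [y [xa yb /rat_atom_ext[v [ux vy]]]]]|[v ua vb]].
  by exists v; rewrite /= ?ux ?vy.
by apply/mem_comp56; exists (rat_atom u v), (rat_atom v w); split=> //; apply: rat_atom_tri.
Qed.

Lemma circle_square : square circle.
Proof. by move=> u v; apply: in_setT. Qed.

(** A point of rank r is sent into the open interval from r to r + 1, where density provides its
    hue. *)
Lemma point_place : exists place : point -> rat, forall p q,
  (p.1 = q.1 -> p = q) -> rat_atom (place p) (place q) = point_atom p q.
Proof.
have ex (p : point) : exists z : rat, [&& (p.1%:R < z)%R, (z < p.1.+1%:R)%R & hue z == p.2].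
  have [|z /andP[z1 z2] z3] := @hue_dense p.1%:R p.1.+1%:R p.2; first by rewrite ltr_nat.
  by exists z; rewrite z1 z2 z3 eqxx.
pose place p := xchoose (ex p).
have lt_place p q : p.1 < q.1 -> (place p < place q)%R.
  move=> pq; have /and3P[_ h1 _] := xchooseP (ex p); have /and3P[h2 _ _] := xchooseP (ex q).
  by apply: lt_trans h1 (le_lt_trans _ h2); rewrite ler_nat.
have hue_place p : hue (place p) = p.2.
  by have /and3P[_ _ /eqP] := xchooseP (ex p).
exists place => p q pq; rewrite /point_atom; case: ltngtP => h.
- by rewrite rat_atom_lt ?lt_place // !hue_place.
- by rewrite rat_atom_gt ?lt_place // !hue_place.
by rewrite pq // rat_atom_id.
Qed.

Lemma circle_universal : universal circle.
Proof.
move=> V f /satisfiable_placed[p [_ pI pf]].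
have [place hp] := point_place.
by exists (fun v => place (p v)) => x y; rewrite /= hp; [apply: pf | apply: pI].
Qed.
End Circle.

(** The circle is itself a square representation, so the exclusion of even cycles applies to the
    identity map. *)
Lemma rat_atom_good : good_coloring rat_atom.
Proof.
have lk (u v : circle) : linked u v by apply: in_setT.
have := rep_good circle_representation (f := id) (fun _ _ e => e) lk.
suff -> : (fun u v : rat => @atom_between circle u v) = rat_atom by [].
apply/funext=> u; apply/funext=> v.
by apply: (atom_betweenE circle_representation); apply: set11.
Qed.

Lemma embeds_trans (A : Type) (C D E : structure A) :
  embeds C D -> embeds D E -> embeds C E.
Proof.
move=> [f fI ff] [g gI gg]; exists (g \o f); first exact: inj_comp.
by move=> a u v; rewrite ff gg.
Qed.

(** * Finite boundedness of the circle *)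

Section Bounds.
Notation size5 := ('I_6 * {ffun ra56_65 * 'I_5 * 'I_5 -> bool})%type.

Definition small_structure (t : size5) : structure ra56_65 :=
  @Structure ra56_65 'I_(t.1) (fun a i j => t.2 (a, inord i, inord j)).

Definition empty_loop : structure ra56_65 :=
  @Structure ra56_65 'I_1 (fun _ _ _ => False).

Lemma empty_loop_circle : ~ embeds empty_loop circle.
Proof.
move=> [e _ /(_ [set: atom] ord0 ord0)[_ h]]; apply: h; exact: in_setT.
Qed.

(** The tables [t] describe all structures on at most five elements. Replacing the embeddable ones
    by [empty_loop], which violates squareness, makes every index yield a structure that does not
    embed into the circle. *)
Definition bound (t : size5) : structure ra56_65 :=
  if `[< embeds (small_structure t) circle >] then empty_loop
  else small_structure t.

Lemma bound_circle t : ~ embeds (bound t) circle.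
Proof.
by rewrite /bound; case: asboolP => // _; apply: empty_loop_circle.
Qed.

Section LocalToGlobal.
Variables (C : structure ra56_65) (V : finType) (g : V -> C) (g' : C -> V).
Hypotheses (gK : cancel g g') (g'K : cancel g' g).
Hypothesis noF : forall t, ~ embeds (bound t) C.

(** If the structure induced on [s] did not embed into the circle, it would itself be a bound
    embedding into [C]. *)
Lemma local_embedding (s : seq V) : size s <= 5 -> exists phi : V -> rat,
  forall u v, u \in s -> v \in s -> (phi u = phi v -> u = v) /\
    forall a, interp a (g u) (g v) <-> rat_atom (phi u) (phi v) \in (a : {set atom}).
Proof.
case: s => [_|u0 s0]; first by exists (fun=> 0%R).
move: (u0 :: s0) => s s5.
have n6 : size (undup s) < 6 by apply: leq_ltn_trans (size_undup s) _.
pose m := [ffun t : ra56_65 * 'I_5 * 'I_5 =>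
  `[< interp t.1.1 (g (nth u0 (undup s) t.1.2)) (g (nth u0 (undup s) t.2)) >]].
pose t : size5 := (Ordinal n6, m).
have tC : embeds (small_structure t) C.
  exists (fun i : 'I_(size (undup s)) => g (nth u0 (undup s) i)).
    move=> i j /(can_inj gK)/eqP; rewrite nth_uniq ?undup_uniq //.
    by move/eqP; apply: val_inj.
  have lt5 (i : 'I_(size (undup s))) : i < 5 by apply: leq_trans (ltn_ord i) _.
  move=> a i j; rewrite /= ffunE /= !inordK ?lt5 //.
  by split=> [/asboolP|h]; last apply/asboolP.
have [h hI hh] : embeds (small_structure t) circle.
  apply/asboolP; apply: contraPT (noF (t := t)) => nt.
  by rewrite /bound (negPf nt).
exists (fun v => if insub (index v (undup s)) is Some i then h i else 0%R).
move=> u v; rewrite -!(mem_undup s) => us vs.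
move: (us) (vs); rewrite -!index_mem => iu iv; rewrite !insubT /=; split.
  by move=> /hI/(congr1 val) /= e; rewrite -(nth_index u0 us) e nth_index.
move=> a; rewrite -[X in _ <-> X]/(@interp _ circle a (h (Ordinal iu)) (h (Ordinal iv))).
have l5 w : w \in undup s -> index w (undup s) < 5.
  by rewrite -index_mem => iw; apply: leq_trans iw _.
rewrite -hh /= ffunE /= (inordK (l5 u us)) (inordK (l5 v vs)) !nth_index //.
by split=> [?|/asboolP //]; apply/asboolP.
Qed.

Definition pair_atom (u v : V) :=
  odflt At_id [pick x | `[< interp ([set x] : ra56_65) (g u) (g v) >]].

Lemma pair_atom_local (s : seq V) : size s <= 5 -> exists phi : V -> rat,
  forall u v, u \in s -> v \in s -> [/\ phi u = phi v -> u = v,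
    pair_atom u v = rat_atom (phi u) (phi v) &
    forall a, interp a (g u) (g v) <-> rat_atom (phi u) (phi v) \in (a : {set atom})].
Proof.
move=> /local_embedding[phi hphi]; exists phi => u v us vs.
have [h1 h2] := hphi u v us vs; split=> //.
rewrite /pair_atom; case: pickP => [x /asboolP/h2|/(_ (rat_atom (phi u) (phi v)))].
  by rewrite in_set1 => /eqP.
by rewrite asboolT //; apply/h2; rewrite set11.
Qed.

(** Each condition on a good colouring concerns at most five vertices and is pulled back from
    [rat_atom] along a local embedding. This is where the size of the bounds comes from. *)
Lemma pair_atom_good : good_coloring pair_atom.
Proof.
have gr := rat_atom_good; split.
- move=> x y; have [phi h] := @pair_atom_local [:: x; y] isT.
  have [_ -> _] := h x y ltac:(by rewrite !inE eqxx ?orbT) ltac:(by rewrite !inE eqxx ?orbT).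
  have [_ -> _] := h y x ltac:(by rewrite !inE eqxx ?orbT) ltac:(by rewrite !inE eqxx ?orbT).
  exact: gc_sym.
- move=> x y; have [phi h] := @pair_atom_local [:: x; y] isT.
  have [i -> _] := h x y ltac:(by rewrite !inE eqxx ?orbT) ltac:(by rewrite !inE eqxx ?orbT).
  by rewrite (gc_id gr); split=> [//|->].
- move=> x y z; have [phi h] := @pair_atom_local [:: x; y; z] isT.
  have e u v : u \in [:: x; y; z] -> v \in [:: x; y; z] ->
    pair_atom u v = rat_atom (phi u) (phi v) by move=> us vs; case: (h u v us vs).
  by rewrite !e ?inE ?eqxx ?orbT // (gc_tri gr).
- move=> x y z t; have [phi h] := @pair_atom_local [:: x; y; z; t] isT.
  have e u v : u \in [:: x; y; z; t] -> v \in [:: x; y; z; t] ->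
    pair_atom u v = rat_atom (phi u) (phi v) by move=> us vs; case: (h u v us vs).
  by rewrite !e ?inE ?eqxx ?orbT //; apply: (gc_C4 gr).
move=> x y z t u; have [phi h] := @pair_atom_local [:: x; y; z; t; u] isT.
have e v w : v \in [:: x; y; z; t; u] -> w \in [:: x; y; z; t; u] ->
  pair_atom v w = rat_atom (phi v) (phi w) by move=> vs ws; case: (h v w vs ws).
by rewrite !e ?inE ?eqxx ?orbT //; apply: (gc_C5 gr).
Qed.

Lemma local_to_global : embeds C circle.
Proof.
have [p [_ pI pc]] := good_placed pair_atom_good.
have [place hp] := point_place.
have rc u v : rat_atom (place (p u)) (place (p v)) = pair_atom u v.
  by rewrite hp ?pc // => /pI ->.
exists (fun u => place (p (g' u))).
  move=> u v /(gc_id rat_atom_good); rewrite rc => /(gc_id pair_atom_good).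
  exact: can_inj g'K _ _.
(* A local embedding of the two points shows that [pair_atom] decides which elements hold between
   them. *)
move=> a u v; have [phi h] := @pair_atom_local [:: g' u; g' v] isT.
have [_ e i] := h (g' u) (g' v) ltac:(by rewrite !inE eqxx ?orbT) ltac:(by rewrite !inE eqxx ?orbT).
by rewrite /= rc e -i !g'K.
Qed.
End LocalToGlobal.

Lemma circle_finitely_bounded : finitely_bounded circle.
Proof.
exists #|{: size5}|, (fun i => bound (enum_val i)); split.
  move=> i; rewrite /bound; case: ifP => _; first by exists 1, id => u; exists u.
  by exists (enum_val i).1, id => u; exists u.
move=> C [n [e eC]]; split=> [CB i /embeds_trans/(_ CB)/bound_circle //|noF].
pose e' (i : 'I_n) : {classic C} := e i.
pose V := seq_sub (codom e').
pose g (v : V) : C := ssval v.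
have inC (u : C) : (u : {classic C}) \in codom e'.
  by have [i <-] := eC u; apply: (codom_f e').
pose g' (u : C) : V := SeqSub (inC u).
apply: (@local_to_global C V g g').
- by move=> v; apply: val_inj.
- by [].
by move=> t; have := noF (enum_rank t); rewrite enum_rankK.
Qed.
End Bounds.

(** * The verifier *)

Lemma nseqS_cat (T : Type) (x : T) n s : nseq n.+1 x ++ s = nseq n x ++ x :: s.
Proof. by elim: n => //= n ->. Qed.

Section TapeEquality.
Variable S : Type.
Implicit Types t : tape S.

(* Equality of tapes up to trailing blanks. *)
Definition teq t t' :=
  nth None t.1 =1 nth None t'.1 /\ nth None t.2 =1 nth None t'.2.

Lemma teq_refl t : teq t t. Proof. by []. Qed.

Lemma teq_trans t2 t1 t3 : teq t1 t2 -> teq t2 t3 -> teq t1 t3.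
Proof. by move=> [h1 h2] [h3 h4]; split=> i; rewrite ?h1 ?h2. Qed.

Lemma teq_read t t' : teq t t' -> tape_read t = tape_read t'.
Proof. by case=> _ /(_ 0); rewrite !nth0. Qed.

Lemma teq_write x t t' : teq t t' -> teq (tape_write x t) (tape_write x t').
Proof.
move=> [h1 h2]; split=> //= -[|i] //=; have := h2 i.+1.
by case: t.2 t'.2 => [|? ?] [|? ?] //=; rewrite nth_nil.
Qed.

Lemma teq_move d t t' : teq t t' -> teq (tape_move d t) (tape_move d t').
Proof.
case: t t' => [l r] [l' r'] [/= h1 h2]; case: d => //; split=> //= i.
- by have := h1 i.+1; case: l l' {h1} => [|? ?] [|? ?] //=; rewrite nth_nil.
- by case: i => [|i] //=; have := h1 0; rewrite !nth0.
- by case: i => [|i] //=; have := h2 0; rewrite !nth0.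
- by have := h2 i.+1; case: r r' {h2} => [|? ?] [|? ?] //=; rewrite nth_nil.
Qed.

Lemma teq_writeK t : teq (tape_write (tape_read t) t) t.
Proof. by case: t => l [|y r]; split=> //= -[|i] //=; rewrite nth_nil. Qed.

Lemma teq_moveR l r : teq (head None l :: behead l, r) (l, r).
Proof. by case: l => [|x l]; split=> //= -[|i] //=; rewrite nth_nil. Qed.
End TapeEquality.

(** [Skip], [Copy] and [Check] parse the input; [Rew0], [Rew1] and [Rew2] rewind the tapes; [Row]
    and [Cell] start a row and an entry; [Cmp], [Lt] and [Gt] compare unary ranks; [Back] returns
    tape 1 to the start of its block and [Fwd] moves it to the next block. *)
Inductive phase :=
  Skip | Copy | Check | Rew0 | Rew1 | Rew2 | Row | Cell | Cmp | Lt | Gt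
| Back | Fwd | Acc | Rej.

Definition phase_code (q : phase) : 'I_15 :=
  inord match q with
  | Skip => 0 | Copy => 1 | Check => 2 | Rew0 => 3 | Rew1 => 4 | Rew2 => 5
  | Row => 6 | Cell => 7 | Cmp => 8 | Lt => 9 | Gt => 10 | Back => 11
  | Fwd => 12 | Acc => 13 | Rej => 14
  end.

Definition phase_decode (i : 'I_15) : phase :=
  nth Rej [:: Skip; Copy; Check; Rew0; Rew1; Rew2; Row; Cell; Cmp; Lt; Gt;
              Back; Fwd; Acc; Rej] i.

Lemma phase_codeK : cancel phase_code phase_decode.
Proof. by case; rewrite /phase_code /phase_decode inordK. Qed.

HB.instance Definition _ := Finite.copy phase (can_type phase_codeK).

(** * A three-tape machine and its running time *)

Section Verifier.
Variables (A K : finType) (test : option bool -> K -> K -> A -> bool).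

Notation mark := (option K).
Notation input := (option (option A + mark)).
Notation sym := (option (input + void)).

Definition net (x : option A) : sym := Some (inl (Some (inl x))).
Definition sep : sym := Some (inl None).
Definition crt (y : mark) : sym := Some (inl (Some (inr y))).

Notation action := (phase * (sym * direction) * (sym * direction) * (sym * direction))%type.

(* Tape 0 holds the network and the certificate, tapes 1 and 2 hold copies of
   the certificate.  For all i and j, the head of tape 1 is on block i, that of
   tape 2 on block j and that of tape 0 on the entry (i, j) of the network. *)
Definition delta (q : phase) (s0 s1 s2 : sym) : action :=
  let mv q d0 d1 d2 := (q, (s0, d0), (s1, d1), (s2, d2)) in
  let rej := mv Rej Stay Stay Stay in
  match q with
  | Skip => match s0 with
    | Some (inl (Some (inl _))) => mv Skip Go_right Stay Stay
    | Some (inl None) => mv Copy Go_right Stay Stay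
    | _ => rej end
  | Copy => match s0 with
    | Some (inl (Some (inr _))) =>
        (Copy, (s0, Go_right), (s0, Go_right), (s0, Go_right))
    | None => mv Check Go_left Go_left Go_left
    | _ => rej end
  | Check => if s1 is Some (inl (Some (inr None))) then rej
             else mv Rew0 Stay Stay Stay
  | Rew0 => if s0 is None then mv Rew1 Go_right Stay Stay
            else mv Rew0 Go_left Stay Stay
  | Rew1 => if s1 is None then mv Rew2 Stay Go_right Stay
            else mv Rew1 Stay Go_left Stay
  | Rew2 => if s2 is None then mv Row Stay Stay Go_right
            else mv Rew2 Stay Stay Go_left
  | Row => if s1 is None
           then if s0 is Some (inl None) then mv Acc Stay Stay Stay else rej
           else mv Cell Stay Stay Stay
  | Cell => if s2 is None
            then if s0 is Some (inl (Some (inl None)))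
                 then mv Fwd Go_right Stay Go_left else rej
            else if s0 is Some (inl (Some (inl (Some _))))
                 then mv Cmp Stay Stay Stay else rej
  | Cmp => match s0, s1, s2 with
    | Some (inl (Some (inl (Some a)))), Some (inl (Some (inr y1))),
      Some (inl (Some (inr y2))) =>
        match y1, y2 with
        | None, None => mv Cmp Stay Go_right Go_right
        | Some k1, Some k2 => if test None k1 k2 a
            then mv Back Go_right Go_left Go_right else rej
        | Some _, None => mv Lt Stay Stay Go_right
        | None, Some _ => mv Gt Stay Go_right Stay
        end
    | _, _, _ => rej end
  | Lt => match s0, s1, s2 with
    | Some (inl (Some (inl (Some a)))), Some (inl (Some (inr (Some k1)))),
      Some (inl (Some (inr y2))) =>
        if y2 is Some k2 then
          if test (Some true) k1 k2 a
          then mv Back Go_right Go_left Go_right else rej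
        else mv Lt Stay Stay Go_right
    | _, _, _ => rej end
  | Gt => match s0, s1, s2 with
    | Some (inl (Some (inl (Some a)))), Some (inl (Some (inr y1))),
      Some (inl (Some (inr (Some k2)))) =>
        if y1 is Some k1 then
          if test (Some false) k1 k2 a
          then mv Back Go_right Go_left Go_right else rej
        else mv Gt Stay Go_right Stay
    | _, _, _ => rej end
  | Back => if s1 is Some (inl (Some (inr None))) then mv Back Stay Go_left Stay
            else mv Cell Stay Go_right Stay
  | Fwd => match s1 with
    | Some (inl (Some (inr None))) => mv Fwd Stay Go_right Stay
    | Some (inl (Some (inr (Some _)))) => mv Rew2 Stay Go_right Stay
    | _ => rej end
  | Acc | Rej => rej
  end.

Definition three (T : Type) (x0 x1 x2 : T) (i : 'I_3) : T :=
  match val i with 0 => x0 | 1 => x1 | _ => x2 end.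

Definition verifier : TM input :=
  @MkTM input void 2 phase Skip
    (fun q => match q with Acc => Some true | Rej => Some false | _ => None end)
    (fun q s => let: (q', a0, a1, a2) :=
       delta q (s (@Ordinal 3 0 isT)) (s (@Ordinal 3 1 isT)) (s (@Ordinal 3 2 isT)) in
       (q', [ffun i => three a0 a1 a2 i])).

Notation tp := (tape (input + void)).

Definition conf (q : phase) (t0 t1 t2 : tp) : config verifier :=
  (q, [ffun i => three t0 t1 t2 i]).

Definition ceq (c c' : config verifier) :=
  c.1 = c'.1 /\ forall i, teq (c.2 i) (c'.2 i).

Lemma ceq_trans c2 c1 c3 : ceq c1 c2 -> ceq c2 c3 -> ceq c1 c3.
Proof.
by move=> [h1 h2] [h3 h4]; split=> [|i]; [rewrite h1|apply: teq_trans (h2 i) (h4 i)].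
Qed.

Lemma ceq_step c c' : ceq c c' -> ceq (tm_step c) (tm_step c').
Proof.
case: c c' => [q t] [q' t'] [/= <- h]; rewrite /tm_step /=.
case: (match q with Acc => _ | Rej => _ | _ => _ end) => //.
have -> : [ffun i => tape_read (t i)] = [ffun i => tape_read (t' i)].
  by apply/ffunP=> i; rewrite !ffunE (teq_read (h i)).
by split=> // i; rewrite !ffunE; apply/teq_move/teq_write.
Qed.

Lemma ceq_iter n c c' : ceq c c' -> ceq (iter n (@tm_step _ verifier) c) (iter n (@tm_step _ verifier) c').
Proof. by move=> h; elim: n => //= n IHn; apply: ceq_step. Qed.

Definition reach (n : nat) (c c' : config verifier) :=
  exists2 t, t <= n & ceq (iter t (@tm_step _ verifier) c) c'.

Definition halts (n : nat) (b : bool) (c : config verifier) :=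
  exists2 t, t <= n & tm_output (iter t (@tm_step _ verifier) c).1 = Some b.

Lemma reach_trans c2 m n k c1 c3 : reach m c1 c2 -> reach n c2 c3 -> m + n <= k -> reach k c1 c3.
Proof.
move=> [t tm h] [t' tn h'] mnk; exists (t' + t); first by lia.
by rewrite iterD; apply: ceq_trans h'; apply: ceq_iter.
Qed.

Lemma reach_halts c2 m n k c1 b : reach m c1 c2 -> halts n b c2 -> m + n <= k -> halts k b c1.
Proof.
move=> [t tm h] [t' tn h'] mnk; exists (t' + t); first by lia.
by rewrite iterD; have [-> _] := ceq_iter t' h.
Qed.

Lemma reachS c2 n c1 c3 : reach 1 c1 c2 -> reach n c2 c3 -> reach n.+1 c1 c3.
Proof. by move=> h1 h2; apply: reach_trans h1 h2 _. Qed.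

Lemma halts_le m n b c : halts m b c -> m <= n -> halts n b c.
Proof. by move=> [t tm h] mn; exists t => //; apply: leq_trans mn. Qed.

Definition outcome (n : nat) (b : bool) (c c' : config verifier) :=
  if b then reach n c c' else halts n false c.

Lemma reach_outcome c2 m n k b c1 c3 : reach m c1 c2 -> outcome n b c2 c3 ->
  m + n <= k -> outcome k b c1 c3.
Proof. by case: b; [apply: reach_trans | apply: reach_halts]. Qed.

Lemma reachS_outcome c2 n b c1 c3 : reach 1 c1 c2 -> outcome n b c2 c3 ->
  outcome n.+1 b c1 c3.
Proof. by move=> h1 h2; apply: reach_outcome h1 h2 _. Qed.

(** A halted configuration is a fixed point of [tm_step], so an outcome reached earlier persists. *)
Lemma halts_outcome n b w : halts n b (tm_init verifier w) ->
  tm_outcome verifier w n = Some b.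
Proof.
move=> [t tn h]; rewrite /tm_outcome -(subnK tn) iterD.
elim: (n - t) => // k; rewrite iterS; set c := iter k _ _ => IHk.
by rewrite /tm_step IHk.
Qed.

Definition is_phase_halt (q : phase) := match q with Acc | Rej => true | _ => false end.

Lemma reach1 q q' t0 t1 t2 t0' t1' t2' a0 a1 a2 : ~~ is_phase_halt q ->
  delta q (tape_read t0) (tape_read t1) (tape_read t2) = (q', a0, a1, a2) ->
  teq (tape_move a0.2 (tape_write a0.1 t0)) t0' ->
  teq (tape_move a1.2 (tape_write a1.1 t1)) t1' ->
  teq (tape_move a2.2 (tape_write a2.1 t2)) t2' ->
  reach 1 (conf q t0 t1 t2) (conf q' t0' t1' t2').
Proof.
move=> qh hd e0 e1 e2; exists 1 => //=; rewrite /tm_step /=.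
have -> : (match q with Acc => Some true | Rej => Some false | _ => None end) = None.
  by case: q qh {hd}.
rewrite !ffunE hd; split=> //= i; rewrite !ffunE.
by case: i => [[|[|[|i]]]] Hi.
Qed.

Lemma reach0 n c : reach n c c. Proof. by exists 0. Qed.

Lemma halts0 n t0 t1 t2 : halts n false (conf Rej t0 t1 t2).
Proof. by exists 0. Qed.

Definition left (t : tp) : tp := tape_move Go_left t.

Lemma ro_stay (t : tp) : teq (tape_move Stay (tape_write (tape_read t) t)) t.
Proof. exact: teq_writeK. Qed.

Lemma ro_left (t : tp) : teq (tape_move Go_left (tape_write (tape_read t) t)) (left t).
Proof. exact/teq_move/teq_writeK. Qed.

Lemma ro_right l x r : teq (tape_move Go_right (tape_write (tape_read (l, x :: r)) (l, x :: r))) ((x :: l, r) : tp).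
Proof. by []. Qed.

Lemma ro_left_right (l r : seq sym) :
  teq (tape_move Go_right (tape_write (tape_read (left (l, r))) (left (l, r)))) ((l, r) : tp).
Proof. exact: (teq_moveR l r). Qed.

Ltac ro := first [exact: ro_stay | exact: ro_left | exact: ro_right
  | exact: ro_left_right | exact: teq_refl].
Ltac run1 := eapply reach1; [by [] | reflexivity | ro | ro | ro].

Lemma reject1 q t0 t1 t2 : ~~ is_phase_halt q ->
  (delta q (tape_read t0) (tape_read t1) (tape_read t2)).1.1.1 = Rej ->
  halts 1 false (conf q t0 t1 t2).
Proof.
case E: (delta _ _ _ _) => [[[q' a0] a1] a2] /= qh qR.
apply: (reach_halts (n := 0) (m := 1)); [apply: (reach1 qh E); exact: teq_refl| |by []].
by rewrite qR; apply: halts0.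
Qed.

Lemma delta_back s0 s1 s2 : s1 <> crt None ->
  delta Back s0 s1 s2 = (Cell, (s0, Stay), (s1, Go_right), (s2, Stay)).
Proof. by case: s1 => [[[[|[]]|]|]|]. Qed.

Lemma delta_check s0 s1 s2 : s1 <> crt None ->
  delta Check s0 s1 s2 = (Rew0, (s0, Stay), (s1, Stay), (s2, Stay)).
Proof. by case: s1 => [[[[|[]]|]|]|]. Qed.

(** The cell before a block is blank or holds the hue closing the previous block; the hypothesis on
    [l] records this and stops the head there. *)
Lemma back_run r (l y : seq sym) t0 t2 : head None l <> crt None ->
  reach r.+1 (conf Back t0 (left (nseq r (crt None) ++ l, y)) t2)
             (conf Cell t0 (l, nseq r (crt None) ++ y) t2).
Proof.
elim: r y => [|r IHr] y hl.
  by eapply reach1; [by []|exact: delta_back|ro|ro|ro].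
rewrite nseqS_cat -nseqS_cat [in X in reach _ _ X]nseqS_cat.
apply: reachS (IHr (crt None :: y) hl).
by run1.
Qed.

Lemma rewind0 (l r : seq sym) t1 t2 : None \notin l ->
  reach (size l).+1 (conf Rew0 (left (l, r)) t1 t2) (conf Rew1 ([::], rev l ++ r) t1 t2).
Proof.
elim: l r => [|x l IHl] r; first by move=> _; run1.
rewrite inE negb_or => /andP[x0 hl]; rewrite rev_cons cat_rcons.
apply: reachS (IHl (x :: r) hl).
by case: x x0 => // x _; run1.
Qed.

Lemma rewind1 (l r : seq sym) t0 t2 : None \notin l ->
  reach (size l).+1 (conf Rew1 t0 (left (l, r)) t2) (conf Rew2 t0 ([::], rev l ++ r) t2).
Proof.
elim: l r => [|x l IHl] r; first by move=> _; run1.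
rewrite inE negb_or => /andP[x0 hl]; rewrite rev_cons cat_rcons.
apply: reachS (IHl (x :: r) hl).
by case: x x0 => // x _; run1.
Qed.

Lemma rewind2 (l r : seq sym) t0 t1 : None \notin l ->
  reach (size l).+1 (conf Rew2 t0 t1 (left (l, r))) (conf Row t0 t1 ([::], rev l ++ r)).
Proof.
elim: l r => [|x l IHl] r; first by move=> _; run1.
rewrite inE negb_or => /andP[x0 hl]; rewrite rev_cons cat_rcons.
apply: reachS (IHl (x :: r) hl).
by case: x x0 => // x _; run1.
Qed.

Lemma forward_run r (l y : seq sym) k t0 t2 :
  reach r.+1 (conf Fwd t0 (l, nseq r (crt None) ++ crt (Some k) :: y) t2)
             (conf Rew2 t0 (crt (Some k) :: nseq r (crt None) ++ l, y) t2).
Proof.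
elim: r l => [|r IHr] l; first by run1.
rewrite [in X in reach _ _ X]nseqS_cat.
apply: reachS (IHr (crt None :: l)).
by run1.
Qed.

Definition order_of (r r' : nat) : option bool :=
  if r == r' then None else Some (r < r').

Section Compare.
Variables (a : A) (l0 r0 l1 l2 y1 y2 : seq sym) (k k' : K).

Lemma final_test q o : ~~ is_phase_halt q ->
  delta q (net (Some a)) (crt (Some k)) (crt (Some k')) =
    (if test o k k' a then (Back, (net (Some a), Go_right), (crt (Some k), Go_left),
       (crt (Some k'), Go_right))
     else (Rej, (net (Some a), Stay), (crt (Some k), Stay), (crt (Some k'), Stay))) ->
  outcome 1 (test o k k' a)
    (conf q (l0, net (Some a) :: r0) (l1, crt (Some k) :: y1) (l2, crt (Some k') :: y2))
    (conf Back (net (Some a) :: l0, r0) (left (l1, crt (Some k) :: y1))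
      (crt (Some k') :: l2, y2)).
Proof.
rewrite /outcome; case: ifP => E qh hd; first by eapply reach1; [|exact: hd|ro|ro|ro].
by apply: reject1; rewrite // hd.
Qed.
End Compare.

Lemma lt_run a l0 r0 l1 l2 y1 y2 k k' r :
  outcome r.+1 (test (Some true) k k' a)
    (conf Lt (l0, net (Some a) :: r0) (l1, crt (Some k) :: y1)
      (l2, nseq r (crt None) ++ crt (Some k') :: y2))
    (conf Back (net (Some a) :: l0, r0) (left (l1, crt (Some k) :: y1))
      (crt (Some k') :: nseq r (crt None) ++ l2, y2)).
Proof.
elim: r l2 => [|r IHr] l2; first exact: final_test.
rewrite [nseq r.+1 _ ++ l2]nseqS_cat; apply: reachS_outcome (IHr _); run1.
Qed.

Lemma gt_run a l0 r0 l1 l2 y1 y2 k k' r :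
  outcome r.+1 (test (Some false) k k' a)
    (conf Gt (l0, net (Some a) :: r0) (l1, nseq r (crt None) ++ crt (Some k) :: y1)
      (l2, crt (Some k') :: y2))
    (conf Back (net (Some a) :: l0, r0)
      (left (nseq r (crt None) ++ l1, crt (Some k) :: y1))
      (crt (Some k') :: l2, y2)).
Proof.
elim: r l1 => [|r IHr] l1; first exact: final_test.
rewrite [nseq r.+1 _ ++ l1]nseqS_cat; apply: reachS_outcome (IHr _); run1.
Qed.

(** The heads consume unary marks in parallel. The rank that ends first is the smaller one, and [Lt]
    or [Gt] reads the rest of the other to reach its hue. *)
Lemma cmp_run a l0 r0 l1 l2 y1 y2 k k' r r' :
  outcome (r + r').+2 (test (order_of r r') k k' a)
    (conf Cmp (l0, net (Some a) :: r0)
      (l1, nseq r (crt None) ++ crt (Some k) :: y1)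
      (l2, nseq r' (crt None) ++ crt (Some k') :: y2))
    (conf Back (net (Some a) :: l0, r0)
      (left (nseq r (crt None) ++ l1, crt (Some k) :: y1))
      (crt (Some k') :: nseq r' (crt None) ++ l2, y2)).
Proof.
elim: r r' l1 l2 => [|r IHr] [|r'] l1 l2.
- apply: (reach_outcome (m := 0) (n := 1)); [exact: reach0|exact: final_test|by []].
- rewrite [nseq r'.+1 _ ++ l2]nseqS_cat add0n; apply: (@reachS_outcome _ r'.+2); first by run1.
  by apply: (reach_outcome (m := 0)) (lt_run _ _ _ _ _ _ _ _ _ _) _; first exact: reach0.
- rewrite [nseq r.+1 _ ++ l1]nseqS_cat addn0; apply: (@reachS_outcome _ r.+2); first by run1.
  by apply: (reach_outcome (m := 0)) (gt_run _ _ _ _ _ _ _ _ _ _) _; first exact: reach0.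
rewrite [nseq r.+1 _ ++ l1]nseqS_cat [nseq r'.+1 _ ++ l2]nseqS_cat.
have -> : order_of r.+1 r'.+1 = order_of r r' by rewrite /order_of eqSS ltnS.
apply: reach_outcome (IHr r' (crt None :: l1) (crt None :: l2)) _; first by run1.
by lia.
Qed.

(* A certificate lists the points, each with its rank in unary followed by its
   hue. *)
Definition block (p : nat * K) : seq mark := rcons (nseq p.1 None) (Some p.2).
Definition blocks (ps : seq (nat * K)) : seq mark := flatten (map block ps).
Definition btape (ps : seq (nat * K)) : seq sym := map crt (blocks ps).

Definition at_block ps ps' : tp := (rev (btape ps), btape ps').

Lemma btape_cat ps ps' : btape (ps ++ ps') = btape ps ++ btape ps'.
Proof. by rewrite /btape /blocks map_cat flatten_cat map_cat. Qed.

Lemma btape_cons p ps : btape (p :: ps) =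
  nseq p.1 (crt None) ++ crt (Some p.2) :: btape ps.
Proof. by rewrite /btape /blocks /= map_cat /block map_rcons map_nseq cat_rcons. Qed.

Lemma rev_btape_rcons ps p : rev (btape (rcons ps p)) =
  crt (Some p.2) :: nseq p.1 (crt None) ++ rev (btape ps).
Proof.
by rewrite -cats1 btape_cat btape_cons cats1 -rcons_cat rev_rcons rev_cat rev_nseq.
Qed.

Lemma head_rev_btape ps : head None (rev (btape ps)) <> crt None.
Proof. by elim/last_ind: ps => // ps p _; rewrite rev_btape_rcons. Qed.

Lemma None_btape ps : None \notin btape ps.
Proof. by apply/mapP => -[]. Qed.

Definition passes (p q : nat * K) (a : A) := test (order_of p.1 q.1) p.2 q.2 a.

Lemma cell_run a l0 r0 ps p ps' qs q qs' :
  outcome (p.1.*2 + q.1 + 4) (passes p q a)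
    (conf Cell (l0, net (Some a) :: r0) (at_block ps (p :: ps')) (at_block qs (q :: qs')))
    (conf Cell (net (Some a) :: l0, r0) (at_block ps (p :: ps'))
       (at_block (rcons qs q) qs')).
Proof.
rewrite /at_block rev_btape_rcons !btape_cons.
have h1 : reach 1 (conf Cell (l0, net (Some a) :: r0)
    (rev (btape ps), nseq p.1 (crt None) ++ crt (Some p.2) :: btape ps')
    (rev (btape qs), nseq q.1 (crt None) ++ crt (Some q.2) :: btape qs'))
  (conf Cmp (l0, net (Some a) :: r0)
    (rev (btape ps), nseq p.1 (crt None) ++ crt (Some p.2) :: btape ps')
    (rev (btape qs), nseq q.1 (crt None) ++ crt (Some q.2) :: btape qs')).
  by case: q.1 => [|n]; run1.
have h2 := cmp_run a l0 r0 (rev (btape ps)) (rev (btape qs)) (btape ps') (btape qs') p.2 q.2 p.1 q.1.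
rewrite /passes; move: h2; rewrite /outcome; case: (test _ _ _ _) => h2.
  have h12 := reachS h1 h2.
  apply: reach_trans h12 (back_run _ _ _ _ (@head_rev_btape ps)) _; lia.
apply: reach_halts h1 h2 _; lia.
Qed.

(** A functional model of one row: the result is the unread part of the network, or [None] when the
    machine rejects. *)
Fixpoint cells p qs (x : seq (option A)) : option (seq (option A)) :=
  match qs, x with
  | [::], None :: x' => Some x'
  | q :: qs', Some a :: x' => if passes p q a then cells p qs' x' else None
  | _, _ => None
  end.

Fixpoint rows ps qs x : bool :=
  if ps is p :: ps' then
    if cells p qs x is Some x' then rows ps' qs x' else false
  else x == [::].

Section Rows.
Variables (all_pts : seq (nat * K)) (R : seq sym) (B : nat).
Hypothesis sizeB : size (btape all_pts) <= B.
Notation inp x := ([seq net i | i <- x] ++ sep :: R).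

Lemma block_bound ps p ps' : ps ++ p :: ps' = all_pts -> p.1 < B.
Proof.
move=> e; apply: leq_trans sizeB.
by rewrite -e btape_cat btape_cons !size_cat /= size_nseq; lia.
Qed.

Lemma row_end_run p ps ps' l0 x : ps ++ p :: ps' = all_pts ->
  reach (2 * B + 3)
    (conf Cell (l0, net None :: x) (at_block ps (p :: ps')) (at_block all_pts [::]))
    (conf Row (net None :: l0, x) (at_block (rcons ps p) ps') (at_block [::] all_pts)).
Proof.
move=> /block_bound pB; rewrite /at_block rev_btape_rcons btape_cons.
apply: (@reach_trans (conf Fwd (net None :: l0, x)
  (rev (btape ps), nseq p.1 (crt None) ++ crt (Some p.2) :: btape ps')
  (left (rev (btape all_pts), [::]))) 1 (2 * B + 2)); [by run1| |by lia].
have Ny : None \notin rev (btape all_pts) by rewrite mem_rev None_btape.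
have h := fun t0 t1 => @rewind2 _ [::] t0 t1 Ny.
rewrite revK cats0 size_rev in h.
by apply: reach_trans (forward_run _ _ _ _ _ _) (h _ _) _; lia.
Qed.

Definition cells_post p ps ps' n c (res : option (seq (option A))) :=
  if res is Some x' then exists l0', reach n c
    (conf Row (l0', inp x') (at_block (rcons ps p) ps') (at_block [::] all_pts))
  else halts n false c.

Lemma cells_post_reach p ps ps' m n k c c' res : reach m c c' ->
  cells_post p ps ps' n c' res -> m + n <= k -> cells_post p ps ps' k c res.
Proof.
case: res => [x|] /= h1 h2 mnk; last exact: reach_halts h1 h2 mnk.
by case: h2 => l0 h2; exists l0; apply: reach_trans h1 h2 mnk.
Qed.

(** All ranks are below [B], so an entry costs at most [3 * B + 4] steps; the end of the row costs
    [2 * B + 3]. *)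
Lemma cells_run p ps ps' qs qs' l0 x :
  ps ++ p :: ps' = all_pts -> qs ++ qs' = all_pts ->
  cells_post p ps ps' (size qs' * (3 * B + 4) + (2 * B + 3))
    (conf Cell (l0, inp x) (at_block ps (p :: ps')) (at_block qs qs'))
    (cells p qs' x).
Proof.
move=> e; elim: qs' qs l0 x => [|q qs' IH] qs l0 [|[a|] x] /= e'.
- by apply: (@halts_le 1); [apply: reject1|lia].
- by apply: (@halts_le 1); [apply: reject1|lia].
- rewrite cats0 in e'; rewrite e'; exists (net None :: l0); exact: row_end_run.
- apply: (@halts_le 1); last by lia.
  by apply: reject1; rewrite // /at_block !btape_cons; case: q.1.
- have := cell_run a l0 (inp x) ps p ps' qs q qs'.
  have pB := block_bound e; have qB := block_bound e'.
  case: (passes p q a) => h /=; last by apply: halts_le h _; lia.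
  apply: cells_post_reach h (IH (rcons qs q) _ x _) _; last by lia.
  by rewrite cat_rcons.
- apply: (@halts_le 1); last by lia.
  by apply: reject1; rewrite // /at_block !btape_cons; case: q.1.
Qed.

Lemma rows_run ps ps' l0 x : ps ++ ps' = all_pts ->
  halts (size ps' * (size all_pts * (3 * B + 4) + (2 * B + 4)) + 1) (rows ps' all_pts x)
    (conf Row (l0, inp x) (at_block ps ps') (at_block [::] all_pts)).
Proof.
elim: ps' ps l0 x => [|p ps' IH] ps l0 x e /=.
  case: x => [|x0 x] /=; last by apply: reject1.
  apply: (reach_halts (m := 1) (n := 0) (c2 := conf Acc (l0, sep :: R) (at_block ps [::]) (at_block [::] all_pts))) => //.
    by run1.
  by exists 0.
have h1 : reach 1 (conf Row (l0, inp x) (at_block ps (p :: ps')) (at_block [::] all_pts))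
    (conf Cell (l0, inp x) (at_block ps (p :: ps')) (at_block [::] all_pts)).
  by rewrite /at_block btape_cons; case: p.1 => [|n]; run1.
have := cells_run (qs := [::]) l0 x e erefl.
case: (cells p all_pts x) => [x'|] /= h2.
  case: h2 => l0' h2; apply: reach_halts h1 (reach_halts h2 (IH _ l0' x' _) (leqnn _)) _.
    by rewrite cat_rcons.
  by rewrite mulSn; lia.
by apply: reach_halts h1 h2 _; rewrite mulSn; lia.
Qed.
End Rows.

(** * Parsing of the input and total running time *)

Definition to_tape (w : seq input) : seq sym := [seq Some (inl i) | i <- w].

Lemma skip_run l x r t1 t2 :
  reach (size x) (conf Skip (l, map net x ++ r) t1 t2)
                 (conf Skip (rev (map net x) ++ l, r) t1 t2).
Proof.
elim: x l => [|i x IH] l; first exact: reach0.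
rewrite /= rev_cons cat_rcons; apply: reachS (IH (net i :: l)); run1.
Qed.

Lemma copy_run l l1 l2 y r :
  reach (size y) (conf Copy (l, map crt y ++ r) (l1, [::]) (l2, [::]))
    (conf Copy (rev (map crt y) ++ l, r) (rev (map crt y) ++ l1, [::]) (rev (map crt y) ++ l2, [::])).
Proof.
elim: y l l1 l2 => [|i y IH] l l1 l2; first exact: reach0.
rewrite /= rev_cons !cat_rcons; apply: reachS (IH (crt i :: l) (crt i :: l1) (crt i :: l2)); run1.
Qed.

Lemma init_conf w : tm_init verifier w = conf Skip ([::], to_tape w) ([::], [::]) ([::], [::]).
Proof.
congr (_, _); apply/ffunP => i; rewrite !ffunE.
by case: i => [[|[|[|i]]]] Hi.
Qed.

Lemma split_while (T : Type) (U : Type) (f : T -> U) (P : U -> bool) (w : seq U) :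
  (forall u, P u -> exists t, u = f t) ->
  exists x r, w = map f x ++ r /\ (if r is u :: _ then ~~ P u else true).
Proof.
move=> hP; elim: w => [|u w [x [r [-> hr]]]]; first by exists [::], [::].
case E: (P u); last by exists [::], (u :: map f x ++ r); rewrite /= E.
by have [t ->] := hP u E; exists (t :: x), r.
Qed.

(** Because every hue closes a block, it suffices that [Check] inspects the last mark. *)
Lemma marks_blocks (y : seq mark) : last None y != None \/ y = [::] ->
  exists ps, y = blocks ps.
Proof.
elim: y => [|d y IH]; first by exists [::].
case=> // hd; have hy : last None y != None \/ y = [::].
  by case: y hd {IH} => [|d' y] h; [right|left].
have [ps e] := IH hy; case: d hd => [k|] hd.
  by exists ((0, k) :: ps); rewrite e.
case: ps e => [|[r k] ps] e; first by rewrite e in hd.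
by exists ((r.+1, k) :: ps); rewrite e.
Qed.

Definition verifier_bound (s : nat) := 100 * s ^ 3 + 100.

Lemma linear_bound s : s + 5 <= verifier_bound s.
Proof.
rewrite /verifier_bound; case: s => [|s] //.
have : s.+1 <= s.+1 ^ 3 by rewrite -{1}(expn1 s.+1) leq_pexp2l.
lia.
Qed.

(** The left side adds the phases in the order of execution, for a network word of length [n] and a
    certificate of length [b] with [m] points. *)
Lemma cubic_bound m b n : m <= b ->
  n + (1 + (b + (1 + (1 + ((b + n.+1).+1 + (b.+1 + (b.+1 +
    (m * (m * (3 * b + 4) + (2 * b + 4)) + 1)))))))) <= verifier_bound (n + b.+1).
Proof.
move=> mb; rewrite /verifier_bound; set s := n + b.+1.
have s0 : 0 < s by rewrite /s addnS.
have bs : b <= s by rewrite /s; lia.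
have ns : n <= s by rewrite /s; lia.
have h : m * (m * (3 * b + 4) + (2 * b + 4)) <= s * (s * (3 * s + 4) + (2 * s + 4)).
  by do ?[apply: leq_mul|apply: leq_add]; lia.
have e : s * (s * (3 * s + 4) + (2 * s + 4)) = 3 * s ^ 3 + 6 * s ^ 2 + 4 * s.
  by rewrite !expnS expn0; lia.
have h2 : s ^ 2 <= s ^ 3 by rewrite leq_pexp2l.
have h1 : s <= s ^ 3 by rewrite -{1}(expn1 s) leq_pexp2l.
by rewrite e in h; lia.
Qed.

Lemma size_btape ps : size ps <= size (btape ps).
Proof. by elim: ps => //= p ps IH; rewrite btape_cons size_cat /=; lia. Qed.

Lemma verifier_accepts x ps :
  let w := word_pair x (blocks ps) in
  halts (verifier_bound (size w)) (rows ps ps x) (tm_init verifier w).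
Proof.
move=> w; rewrite init_conf.
have ew : to_tape w = map net x ++ sep :: btape ps.
  by rewrite /to_tape /w /word_pair map_cat /= /btape -!map_comp.
have sw : size w = size x + (size (btape ps)).+1.
  by rewrite -(size_map (fun i => Some (inl i) : sym)) -/(to_tape w) ew size_cat /= size_map.
rewrite ew.
set y := btape ps.
have h1 := skip_run [::] x (sep :: y) ([::], [::]) ([::], [::]).
pose L := sep :: rev (map net x) ++ [::].
have h2 : reach 1 (conf Skip (rev (map net x) ++ [::], sep :: y) ([::], [::]) ([::], [::]))
   (conf Copy (L, y) ([::], [::]) ([::], [::])) by run1.
have h3 := copy_run L [::] [::] (blocks ps) [::]; rewrite !cats0 -/(btape ps) -/y in h3.
have h4 : reach 1 (conf Copy (rev y ++ L, [::]) (rev y, [::]) (rev y, [::]))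
   (conf Check (left (rev y ++ L, [::])) (left (rev y, [::])) (left (rev y, [::]))) by run1.
have h5 : reach 1 (conf Check (left (rev y ++ L, [::])) (left (rev y, [::])) (left (rev y, [::])))
   (conf Rew0 (left (rev y ++ L, [::])) (left (rev y, [::])) (left (rev y, [::]))).
  have hy : tape_read (left (rev y, [::])) <> crt None by apply: head_rev_btape.
  by eapply reach1; [by []|exact: delta_check hy|ro|ro|ro].
have NL : None \notin rev y ++ L.
  rewrite mem_cat mem_rev negb_or None_btape /L cats0 inE /= mem_rev.
  by apply/mapP=> -[].
have Ny : None \notin rev y by rewrite mem_rev None_btape.
have h6 := @rewind0 _ [::] (left (rev y, [::])) (left (rev y, [::])) NL.
have h7 := @rewind1 _ [::] ([::], rev (rev y ++ L) ++ [::]) (left (rev y, [::])) Ny.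
have h8 := @rewind2 _ [::] ([::], rev (rev y ++ L) ++ [::]) ([::], rev (rev y) ++ [::]) Ny.
have h9 := @rows_run ps y (size y) (leqnn _) [::] ps [::] x erefl.
have eL : rev (rev y ++ L) ++ [::] = map net x ++ sep :: y.
  by rewrite /L !cats0 rev_cat revK rev_cons revK cat_rcons.
have ey : rev (rev y) ++ [::] = y by rewrite cats0 revK.
rewrite eL ey in h6 h7 h8.
have ht := reach_halts h1 (reach_halts h2 (reach_halts h3 (reach_halts h4 (reach_halts h5
  (reach_halts h6 (reach_halts h7 (reach_halts h8 h9 (leqnn _)) (leqnn _)) (leqnn _)) (leqnn _)) (leqnn _)) (leqnn _)) (leqnn _)) (leqnn _).
have [t tn ht'] := ht; exists t => //; apply: leq_trans tn _.
rewrite sw; apply: leq_trans (cubic_bound _ (size_btape ps)); rewrite -/y.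
by rewrite size_cat /L /= cats0 !size_rev !size_map -(size_map crt (blocks ps)).
Qed.

(** A malformed word is detected during [Skip], [Copy] or [Check], hence in linear time. *)
Lemma verifier_total w :
  (exists x ps, w = word_pair x (blocks ps)) \/
  halts (verifier_bound (size w)) false (tm_init verifier w).
Proof.
have [x [r [ew hr]]] := @split_while (option A) input (fun i => Some (inl i))
  (fun u => if u is Some (inl _) then true else false) w
  ltac:(by case=> [[i|]|] // _; exists i).
have fin n c : reach n (tm_init verifier w) c -> halts 1 false c -> n <= size w + 4 ->
    halts (verifier_bound (size w)) false (tm_init verifier w).
  move=> h1 h2 nw; apply: (@halts_le (size w + 5)); last exact: linear_bound.
  by apply: reach_halts h1 h2 _; lia.
have h1 : reach (size x) (tm_init verifier w)
    (conf Skip (rev (map net x), to_tape r) ([::], [::]) ([::], [::])).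
  rewrite init_conf ew /to_tape map_cat -map_comp -[rev _]cats0.
  exact: skip_run.
case: r hr ew h1 => [|[[i|d]|] r] // _ ew h1.
- by right; apply: fin h1 _ _; [apply: reject1|rewrite ew size_cat size_map; lia].
- by right; apply: fin h1 _ _; [apply: reject1|rewrite ew size_cat size_map; lia].
have [y [r' [er hr']]] := @split_while mark input (fun i => Some (inr i))
  (fun u => if u is Some (inr _) then true else false) r
  ltac:(by case=> [[|i]|] // _; exists i).
have h2 : reach (size x + (1 + size y)) (tm_init verifier w)
    (conf Copy (rev (map crt y) ++ sep :: rev (map net x), to_tape r')
      (rev (map crt y), [::]) (rev (map crt y), [::])).
  apply: reach_trans h1 _ (leqnn _); apply: (@reachS (conf Copy
    (sep :: rev (map net x), to_tape r) ([::], [::]) ([::], [::]))); first by run1.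
  have := copy_run (sep :: rev (map net x)) [::] [::] y (to_tape r').
  by rewrite er /to_tape map_cat -map_comp !cats0.
have sw : size x + (1 + size y) <= size w by rewrite ew er !size_cat /= size_cat !size_map; lia.
case: r' er hr' h2 => [|[[i|d]|] r'] // er _ h2.
- rewrite cats0 in er; case: (lastP y) er h2 sw => [|y' d] er h2 sw.
    by left; exists x, [::]; rewrite ew er.
  case: d er h2 sw => [k|] er h2 sw.
    have [|ps eps] := @marks_blocks (rcons y' (Some k)); first by left; rewrite last_rcons.
    by left; exists x, ps; rewrite ew er eps.
  right; apply: fin (reach_trans h2 (_ : reach 1 _ _) (leqnn _)) _ _; [by run1| |lia].
  by apply: reject1; rewrite // map_rcons rev_rcons.
- by right; apply: fin h2 _ _; [apply: reject1|lia].
by right; apply: fin h2 _ _; [apply: reject1|lia].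
Qed.

Definition verified : language input :=
  fun w => tm_outcome verifier w (verifier_bound (size w)) = Some true.

Lemma verified_in_P : in_P verified.
Proof.
exists verifier, 100, 3 => w; rewrite /verified -/(verifier_bound (size w)).
have [b h] : exists b, halts (verifier_bound (size w)) b (tm_init verifier w).
  case: (verifier_total w) => [[x [ps ->]]|h]; last by exists false.
  by exists (rows ps ps x); apply: verifier_accepts.
exists b; first exact: halts_outcome.
by rewrite (halts_outcome h); case: b {h}.
Qed.

Lemma verifiedP x y :
  verified (word_pair x y) <-> exists2 ps, y = blocks ps & rows ps ps x.
Proof.
split=> [v|[ps -> h]]; last first.
  by rewrite /verified (halts_outcome (verifier_accepts x ps)) h.
case: (verifier_total (word_pair x y)) => [[x' [ps e]]|h]; last first.
  by rewrite /verified (halts_outcome h) in v.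
(* The separator occurs once in each word, so it determines both parts. *)
have [ex ey] : x = x' /\ y = blocks ps.
  move: e; rewrite /word_pair; elim: x x' {v} => [|i x IH] [|i' x'] //=.
    by case=> /(inj_map _) -> // d d' [].
  by case=> -> /IH[-> ->].
exists ps => //; move: v; rewrite /verified ey (halts_outcome (verifier_accepts x ps)).
by case.
Qed.

(** * Accepted words as encoded networks *)

Lemma cells_complete p (I : Type) (q : I -> nat * K) (g : I -> A) (s : seq I) x :
  (forall j, passes p (q j) (g j)) ->
  cells p (map q s) (rcons [seq Some (g j) | j <- s] None ++ x) = Some x.
Proof. by move=> h; elim: s => //= j s ->; rewrite h. Qed.

Lemma rows_complete (n : nat) (p : 'I_n -> nat * K) (f : network A 'I_n) :
  (forall i j, passes (p i) (p j) (f i j)) ->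
  rows (map p (enum 'I_n)) (map p (enum 'I_n)) (encode_network f).
Proof.
move=> h; rewrite /encode_network; set s := enum 'I_n in |- *.
(* Only the enumeration of the rows is generalised; the columns still run over all vertices. *)
move: {1 4}s => t; elim: t => //= i t IHt.
by rewrite cells_complete.
Qed.

Lemma cells_sound a0 p qs x x' : cells p qs x = Some x' -> exists row : seq A,
  [/\ size row = size qs, x = rcons (map Some row) None ++ x' &
      forall j, j < size qs -> forall q0, passes p (nth q0 qs j) (nth a0 row j)].
Proof.
elim: qs x => [|q qs IH] [|[a|] x] //=; first by case=> <-; exists [::].
case: ifP => // h /IH[row [e1 -> e3]]; exists (a :: row); split=> //=.
  by rewrite e1.
by case=> [|j] //= jq q0; apply: e3.
Qed.

Lemma rows_sound a0 ps qs x : rows ps qs x -> exists M : seq (seq A),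
  [/\ size M = size ps, x = flatten [seq rcons (map Some row) None | row <- M] &
      forall i, i < size ps -> size (nth [::] M i) = size qs /\
        forall j, j < size qs -> forall q0,
          passes (nth q0 ps i) (nth q0 qs j) (nth a0 (nth [::] M i) j)].
Proof.
elim: ps x => [|p ps IH] x /=; first by move/eqP=> ->; exists [::].
case E: (cells p qs x) => [x'|] // /IH[M [e1 e2 e3]].
have [row [h1 h2 h3]] := cells_sound a0 E.
exists (row :: M); split=> /=; [by rewrite e1|by rewrite h2 e2|].
by case=> [_|i] /=; [split|apply: e3].
Qed.

Lemma rows_network (a0 : A) ps x : rows ps ps x -> exists f : network A 'I_(size ps),
  x = encode_network f /\
  forall (i j : 'I_(size ps)) q0, passes (nth q0 ps i) (nth q0 ps j) (f i j).
Proof.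
move=> /(rows_sound a0)[M [e1 -> e3]].
exists (fun i j : 'I_(size ps) => nth a0 (nth [::] M i) j); split; last first.
  by move=> i j q0; have [_ h] := e3 i (ltn_ord i); apply: h.
rewrite /encode_network; congr flatten.
apply: (@eq_from_nth _ [::]); first by rewrite size_map [RHS]size_map size_enum_ord.
rewrite size_map => i iM; rewrite e1 in iM; pose i' := Ordinal iM.
rewrite (nth_map [::]) ?e1 // (nth_map i') ?size_enum_ord // nth_enum_ord //.
have [sM _] := e3 i iM; congr rcons.
apply: (@eq_from_nth _ None); first by rewrite size_map [RHS]size_map size_enum_ord.
rewrite size_map sM => j jp; pose j' := Ordinal jp.
by rewrite (nth_map a0) ?sM // (nth_map j') ?size_enum_ord // nth_enum_ord.
Qed.
End Verifier.

(** * The network satisfaction problem in NP *)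

Definition hue_test (o : option bool) (k k' : 'I_6) (a : {set atom}) : bool :=
  match o with
  | None => (k == k') && (At_id \in a)
  | Some true => sector_atom (k' + 6 - k) \in a
  | Some false => sector_atom (k + 6 - k') \in a
  end.

(** As [point_atom] ignores the hues at equal ranks, the test must also compare these hues; then
    equal ranks mean equal points, as [point_place] requires. *)
Lemma passes_point (p q : point) (a : {set atom}) :
  passes hue_test p q a <-> (p.1 = q.1 -> p = q) /\ point_atom p q \in a.
Proof.
case: p q => [r k] [r' k']; rewrite /passes /order_of /point_atom /=.
case: ltngtP => h /=.
- by split=> [e|[]//]; split=> // e'; rewrite e' ltnn in h.
- by split=> [e|[]//]; split=> // e'; rewrite e' ltnn in h.
rewrite h; split=> [/andP[/eqP -> ->]|[/(_ erefl)[->] ->]] //.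
by rewrite eqxx.
Qed.

Lemma size_encode_network (A : Type) n (f : network A 'I_n) :
  size (encode_network f) = n * n.+1.
Proof.
rewrite /encode_network size_flatten /shape -map_comp sumnE big_map.
under eq_bigr => i _ do rewrite /= size_rcons size_map size_enum_ord.
by rewrite big_const_seq count_predT size_enum_ord iter_addn_0 mulnC.
Qed.

Lemma size_blocks (I : Type) (K : finType) n (p : I -> nat * K) (s : seq I) :
  (forall i, (p i).1 < n) -> size (blocks (map p s)) <= size s * n.
Proof.
move=> pn; elim: s => //= i s IHs.
by rewrite /blocks /= size_cat size_rcons size_nseq mulSn leq_add.
Qed.

Lemma NSP_in_NP : in_NP (NSP ra56_65).
Proof.
(* Linear certificates suffice: ranks below n give n blocks of length at most n, while the network
   word has length n(n + 1). *)
exists (option 'I_6 : finType), (@verified {set atom} 'I_6 hue_test), 1, 1.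
split; first exact: verified_in_P.
move=> x; split.
  move=> [n [f [-> /satisfiable_placed[p [pn pI pf]]]]].
  rewrite card_ord in pn.
  exists (blocks (map p (enum 'I_n))).
    rewrite size_encode_network mul1n expn1; apply: leq_trans (size_blocks _ pn) _.
    by rewrite size_enum_ord mulnS; lia.
  apply/verifiedP; exists (map p (enum 'I_n)) => //.
  by apply: (@rows_complete {set atom}) => i j; apply/passes_point; split; [apply: pI|apply: pf].
move=> [y _ /verifiedP[ps _ /(rows_network set0)[f [-> hf]]]].
(* The number of vertices is read off from the certificate, one block for each vertex. *)
exists (size ps), f; split=> //.
exists circle; first exact: circle_representation.
have [place hp] := point_place.
exists (fun i : 'I_(size ps) => place (nth (0, ord0) ps i)) => i j.
have /passes_point[h1 h2] := hf i j (0, ord0).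
by rewrite /= hp.
Qed.

Theorem theorem1p4 :
  (exists B : structure ra56_65,
     [/\ representation B, square B, universal B & finitely_bounded B]) /\
  in_NP (NSP ra56_65).
Proof.
split; last exact: NSP_in_NP.
exists circle; split.
- exact: circle_representation.
- exact: circle_square.
- exact: circle_universal.
exact: circle_finitely_bounded.
Qed.
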